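(* Let $X:M\to\mathbb{R}^3_1$ be a proper conformal maximal immersion of a Riemann surface $M$ with $\partial(M)\neq\emptyset$, and suppose that $\partial(M)$ consists of a countable union of pairwise disjoint loops determining conelike singularities. Then $M$ is relative parabolic.
   Context: $\mathbb{R}^3_1$ denotes the Lorentz-Minkowski space: $\mathbb{R}^3$ with the metric $\langle\,,\rangle = dx_1^2+dx_2^2-dx_3^2$. $\pi_0:\mathbb{R}^3\to\{x_3=0\}$ is the orthogonal projection $(x_1,x_2,x_3)\mapsto(x_1,x_2,0)$. Surfaces with boundary. Riemann surfaces are connected. A Riemann surface $M$ with $\partial(M)\neq\emptyset$ is assumed to satisfy $M\subseteq M'$ for an open Riemann surface $M'$; $\partial(M)\subset M$ is the topological frontier of $M$ in $M'$ and consists of a proper (without accumulation) family of pairwise disjoint closed curves in $M'$, at least piecewise $\mathcal{C}^1$. $\mathrm{Int}(M)=M-\partial(M)$. Maps on $M$ are called smooth (conformal, harmonic, meromorphic, ...) if they are restrictions of such maps on $M'$. Maximal immersions. A smooth map $X:M\to\mathbb{R}^3_1$ is spacelike if the metric induced from $\langle\,,\rangle$ is Riemannian at every point of $\mathrm{Int}(M)$. A conformal map $X:M\to\mathbb{R}^3_1$ is a (conformal) maximal immersion if it is spacelike and $X|_{\mathrm{Int}(M)}$ has zero mean curvature. The Weierstrass data of $X$ are assumed to extend meromorphically beyond $\partial(M)$. Conelike singularities. A curve in $\partial(M)$ is singular if at all its points the tangent plane with the induced metric is not Riemannian. A singular loop $\gamma\subseteq\partial(M)$ determines an isolated lightlike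 singularity if $X(\gamma)$ is a single point. In this case let $\hat M$ be the quotient of $M$ obtained by identifying all points of $\gamma$ with a single point $\hat\gamma$, and let $\hat X:\hat M\to\mathbb{R}^3_1$ be the map induced by $X$. The loop $\gamma$ determines a conelike singularity $X(\gamma)=\hat X(\hat\gamma)$ if $\pi_0\circ\hat X:\hat M\to\{x_3=0\}$ is an embedding locally around $\hat\gamma$. Relative parabolicity. A Riemann surface $R$ with $\partial(R)\neq\emptyset$ is relative parabolic if the only bounded harmonic function $f$ on $R$ vanishing on $\partial(R)$ is $f=0$. *)

(* Defs.v *)
From HB Require Import structures.
From mathcomp Require Import all_boot all_order all_algebra.
From mathcomp Require Import all_classical all_reals all_analysis.
From mathcomp Require Import complex.

Set Implicit Arguments.
Unset Strict Implicit.
Unset Printing Implicit Defensive.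

Import Order.TTheory GRing.Theory Num.Theory.
Import numFieldNormedType.Exports.

Local Open Scope classical_set_scope.
Local Open Scope ring_scope.

Section Plane.
Context {R : realType}.
Local Notation C := (R[i]^o).

Definition cplx (p : R * R) : C := (p.1 +i* p.2)%C.
Definition uncplx (z : C) : R * R := (complex.Re z, complex.Im z).

Definition holomorphic_on (D : set C) (h : C -> C) : Prop :=
  forall z, D z -> derivable (h : C^o -> C^o) z 1.

(* The values of h at its poles, or at any isolated point, are irrelevant. *)
Definition meromorphic_on (D : set C) (h : C -> C) : Prop :=
  forall z0, D z0 -> exists (k : nat) (a : C -> C),
    (\forall z \near z0, derivable (a : C^o -> C^o) z 1) /\
    (\forall z \near z0^', h z = a z / (z - z0) ^+ k).

Definition e1 : R * R := (1, 0).
Definition e2 : R * R := (0, 1).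

Fixpoint Ck {V : normedModType R} (k : nat) (D : set (R * R)) (u : R * R -> V)
    : Prop :=
  match k with
  | 0%N => forall p, D p -> {for p, continuous u}
  | k'.+1 => (forall p, D p -> differentiable u p) /\
             Ck k' D ('D_e1 u) /\ Ck k' D ('D_e2 u)
  end.

Definition laplacian (u : R * R -> R) (p : R * R) : R :=
  'D_e1 ('D_e1 u) p + 'D_e2 ('D_e2 u) p.

End Plane.

Section Surfaces.
Context {R : realType} {T : topologicalType}.
Local Notation C := (R[i]^o).

Record chart := Chart {
  chart_dom : set T;
  chart_map : T -> C;
  chart_inv : C -> T;
  chart_dom_open : open chart_dom;
  chart_img_open : open (chart_map @` chart_dom);
  chart_mapK : forall q, chart_dom q -> chart_inv (chart_map q) = q;
  chart_map_cont : {within chart_dom, continuous chart_map};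
  chart_inv_cont : {within chart_map @` chart_dom, continuous chart_inv} }.

Definition transition (c c' : chart) : C -> C := chart_map c' \o chart_inv c.

Record riemann_surface (A : set chart) : Prop := {
  rs_hausdorff : hausdorff_space T;
  rs_connected : connected [set: T];
  rs_cover : \bigcup_(c in A) chart_dom c = setT;
  rs_compat : forall c c', A c -> A c' ->
    holomorphic_on (chart_map c @` (chart_dom c `&` chart_dom c'))
      (transition c c') }.

Definition open_riemann_surface (A : set chart) : Prop :=
  riemann_surface A /\ ~ compact [set: T].

Section LocalExpressions.
Variables (c : chart) (V : normedModType R).

Definition coord (q : T) : R * R := uncplx (chart_map c q).

Definition coord_image (S : set T) : set (R * R) :=
  coord @` (chart_dom c `&` S).

Definition local_expr (f : T -> V) : R * R -> V :=
  fun p => f (chart_inv c (cplx p)).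

End LocalExpressions.

Definition smooth_map (A : set chart) (V : normedModType R) (S : set T)
    (f : T -> V) : Prop :=
  forall c, A c -> forall k, Ck k (coord_image c S) (local_expr c f).

Definition harmonic (A : set chart) (S : set T) (f : T -> R) : Prop :=
  forall c, A c ->
    Ck 2 (coord_image c S) (local_expr c f) /\
    (forall p, coord_image c S p -> laplacian (local_expr c f) p = 0).

Definition frontier (M : set T) : set T := closure M `\` interior M.

(* The limits at t are two-sided also at the end points of [a, b]: a curve that
   is C^1 on [a, b] up to the end points is one that coincides there with such
   a d. *)
Definition C1_curve (A : set chart) (a b : R) (d : R -> T) : Prop :=
  forall t, t \in `[a, b] ->
    {for t, continuous d} /\
    forall c, A c -> chart_dom c (d t) ->
      (\forall s \near t, derivable (coord c \o d) s 1) /\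
      {for t, continuous (derive1 (coord c \o d))}.

(* Simple closed curve, parametrised by [0, 1]. *)
Definition piecewise_C1_loop (A : set chart) (gamma : set T) : Prop :=
  exists l : R -> T,
    [/\ {within `[0, 1], continuous l},
        l 0 = l 1,
        (forall s t, s \in `[0, 1[ -> t \in `[0, 1[ -> l s = l t -> s = t),
        gamma = l @` `[0, 1] &
        exists (n : nat) (t : nat -> R),
          [/\ t 0%N = 0, t n = 1 &
              forall i, (i < n)%N ->
                t i < t i.+1 /\
                exists2 d : R -> T, C1_curve A (t i) (t i.+1) d &
                  {in `[t i, t i.+1], l =1 d}]].

(* M is a surface with boundary inside the surface with atlas A; L is the
   family of its boundary curves, all of them loops, and Int(M) is the
   topological interior of M.  The condition M = closure (interior M) excludes
   sets such as a bare curve, which are not surfaces. *)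
Record bordered_surface (A : set chart) (M : set T) (L : set (set T)) : Prop := {
  bs_closed : closed M;
  bs_connected : connected M;
  bs_regular : closure (interior M) = M;
  bs_frontier : frontier M = \bigcup_(gamma in L) gamma;
  bs_loops : forall gamma, L gamma -> piecewise_C1_loop A gamma;
  bs_disjoint : trivIset L id;
  bs_locally_finite : forall q : T, exists2 U : set T, nbhs q U &
    finite_set [set gamma | L gamma /\ gamma `&` U !=set0] }.

(* Bounded functions are tested in the usual class: continuous on M and
   harmonic in the interior.  It contains the restrictions to M of functions
   harmonic on a neighbourhood of M. *)
Definition relative_parabolic (A : set chart) (M : set T) : Prop :=
  forall f : T -> R,
    {within M, continuous f} ->
    harmonic A (interior M) f ->
    (exists B : R, forall q, M q -> `|f q| <= B) ->
    (forall q, frontier M q -> f q = 0) ->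
    forall q, M q -> f q = 0.

Local Notation L3 := 'rV[R]_3.

Definition i1 : 'I_3 := inord 0.
Definition i2 : 'I_3 := inord 1.
Definition i3 : 'I_3 := inord 2.

Definition lorentz (u v : L3) : R :=
  u 0 i1 * v 0 i1 + u 0 i2 * v 0 i2 - u 0 i3 * v 0 i3.

Definition pi0 (x : L3) : L3 := \row_j (if j == i3 then 0 else x 0 j).

(* lorentz (lorentz_cross u v) w is the determinant of (u, v, w). *)
Definition lorentz_cross (u v : L3) : L3 :=
  \row_j (if j == i1 then u 0 i2 * v 0 i3 - u 0 i3 * v 0 i2
          else if j == i2 then u 0 i3 * v 0 i1 - u 0 i1 * v 0 i3
          else - (u 0 i1 * v 0 i2 - u 0 i2 * v 0 i1)).

Section LocalGeometry.
Variables (X : T -> L3) (c : chart) (q : T).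
Local Notation x := (local_expr c X).
Local Notation p := (coord c q).

Definition first_form (v w : R * R) : R := lorentz ('D_v x p) ('D_w x p).

(* On a spacelike tangent plane the cross product n is timelike. *)
Definition unit_normal : L3 :=
  let n := lorentz_cross ('D_e1 x p) ('D_e2 x p) in
  (Num.sqrt (- lorentz n n))^-1 *: n.

Definition second_form (v w : R * R) : R :=
  lorentz ('D_v ('D_w x) p) unit_normal.

Definition mean_curvature : R :=
  (first_form e2 e2 * second_form e1 e1
   - 2 * first_form e1 e2 * second_form e1 e2
   + first_form e1 e1 * second_form e2 e2)
  / (2 * (first_form e1 e1 * first_form e2 e2 - first_form e1 e2 ^+ 2)).

(* Coefficient of dz in phi_j = 2 (dX_j / dz) dz, in the coordinate c. *)
Definition phi (j : 'I_3) : C :=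
  (('D_e1 x p) 0 j -i* ('D_e2 x p) 0 j)%C.

End LocalGeometry.

Definition riemannian_at (A : set chart) (X : T -> L3) (q : T) : Prop :=
  forall c, A c -> chart_dom c q ->
    forall v : R * R, v != 0 -> 0 < first_form X c q v v.

Definition spacelike (A : set chart) (M : set T) (X : T -> L3) : Prop :=
  forall q, interior M q -> riemannian_at A X q.

(* The conformal factor may vanish: a maximal immersion is degenerate along
   singular boundary curves.  It is positive wherever X is spacelike. *)
Definition conformal (A : set chart) (X : T -> L3) : Prop :=
  forall q c, A c -> chart_dom c q ->
    exists2 lambda : R, 0 <= lambda &
      forall v w : R * R,
        first_form X c q v w = lambda * (v.1 * w.1 + v.2 * w.2).

Definition zero_mean_curvature (A : set chart) (S : set T) (X : T -> L3) : Prop :=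
  forall q c, S q -> A c -> chart_dom c q -> mean_curvature X c q = 0.

Definition meromorphic_function (A : set chart) (U : set T) (g : T -> C) : Prop :=
  forall c, A c ->
    meromorphic_on (chart_map c @` (chart_dom c `&` U)) (g \o chart_inv c).

(* A 1-form is given by its coefficients: w c z dz in the coordinate c. *)
Definition meromorphic_form (A : set chart) (U : set T) (w : chart -> C -> C)
    : Prop :=
  (forall c, A c -> meromorphic_on (chart_map c @` (chart_dom c `&` U)) (w c)) /\
  (forall c c' q, A c -> A c' -> U q -> chart_dom c q -> chart_dom c' q ->
     w c (chart_map c q) =
     w c' (chart_map c' q)
       * derive1 (transition c c' : C -> C^o) (chart_map c q)).

(* (g, phi_3) are the Weierstrass data of X on the open set S:
   phi_1 = i/2 (1/g - g) phi_3 and phi_2 = -1/2 (1/g + g) phi_3.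
   The identities are between meromorphic objects, hence off isolated points. *)
Definition weierstrass_data (A : set chart) (S : set T) (X : T -> L3)
    (g : T -> C) (w : chart -> C -> C) : Prop :=
  forall c q0, A c -> chart_dom c q0 -> S q0 ->
    \forall z \near (chart_map c q0)^',
      let q := chart_inv c z in
      [/\ g q != 0,
          phi X c q i1 = 'i%C / 2 * ((g q)^-1 - g q) * w c z,
          phi X c q i2 = - (1 / 2) * ((g q)^-1 + g q) * w c z &
          phi X c q i3 = w c z].

Record conformal_maximal_immersion (A : set chart) (M : set T) (X : T -> L3)
    : Prop := {
  cmi_smooth : smooth_map A setT X;
  cmi_conformal : conformal A X;
  cmi_spacelike : spacelike A M X;
  cmi_maximal : zero_mean_curvature A (interior M) X;
  cmi_weierstrass : exists (U : set T) (g : T -> C) (w : chart -> C -> C),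
    [/\ open U, M `<=` U, meromorphic_function A U g, meromorphic_form A U w &
        weierstrass_data A (interior M) X g w] }.

Definition proper_on (M : set T) (X : T -> L3) : Prop :=
  forall K : set L3, compact K -> compact (M `&` X @^-1` K).

Section Quotient.
Variables (M gamma : set T).
Local Open Scope quotient_scope.

Definition collapse_rel (p q : M) : bool :=
  (p == q) || `[< gamma (val p) /\ gamma (val q) >].

Lemma collapse_rel_refl : reflexive collapse_rel.
Proof. by move=> p; rewrite /collapse_rel eqxx. Qed.

Lemma collapse_rel_sym : symmetric collapse_rel.
Proof.
move=> p q; rewrite /collapse_rel eq_sym; congr (_ || _).
by apply/asboolP/asboolP => -[].
Qed.

Lemma collapse_rel_trans : transitive collapse_rel.
Proof.
move=> q p r /orP[/eqP -> //|/asboolP[gp gq]] /orP[/eqP <-|/asboolP[_ gr]];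
  by apply/orP; right; apply/asboolP.
Qed.

Canonical collapse_equiv :=
  EquivRel collapse_rel collapse_rel_refl collapse_rel_sym collapse_rel_trans.

(* M with the points of gamma identified, with the quotient topology. *)
Definition collapsed : topologicalType :=
  quotient_topology {eq_quot collapse_equiv}.

Definition collapse : M -> collapsed := \pi_{eq_quot collapse_equiv}.

(* The map induced on the quotient, for X constant on gamma. *)
Definition induced_map (X : T -> L3) : collapsed -> L3 :=
  fun m => X (val (repr (m : {eq_quot collapse_equiv}))).

End Quotient.

Definition embedding_on (Y Z : topologicalType) (U : set Y) (f : Y -> Z) : Prop :=
  {within U, continuous f} /\
  exists h : Z -> Y, {within f @` U, continuous h} /\ (forall y, U y -> h (f y) = y).

Definition singular_curve (A : set chart) (X : T -> L3) (gamma : set T) : Prop :=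
  forall q, gamma q -> ~ riemannian_at A X q.

Definition conelike_singularity (A : set chart) (M : set T) (X : T -> L3)
    (gamma : set T) : Prop :=
  [/\ singular_curve A X gamma,
      (exists x : L3, X @` gamma = [set x]) &
      exists U : set (collapsed M gamma),
        [/\ open U,
            (forall q : M, gamma (val q) -> U (collapse gamma q)) &
            embedding_on U (pi0 \o induced_map (gamma := gamma) X)]].

End Surfaces.

Arguments chart : clear implicits.

(* Main.v *)
Require Import Defs.
From HB Require Import structures.
From mathcomp Require Import all_boot all_order all_algebra.
From mathcomp Require Import all_classical all_reals all_analysis.
From mathcomp Require Import finmap complex.
From mathcomp Require Import ring lra.
(* Gives [coord], the coordinates in a chart, precedence over the homonym for
   bases of vector spaces. *)
Import Defs.

Set Implicit Arguments.
Unset Strict Implicit.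
Unset Printing Implicit Defensive.

Import Order.TTheory GRing.Theory Num.Theory.
Import numFieldNormedType.Exports.

Local Open Scope classical_set_scope.
Local Open Scope ring_scope.

(** Write X = (F, u), with F the projection of X to the spacelike plane and u its
    third coordinate, and identify two points of M when they lie on a common
    boundary loop.  The argument has two parts, a geometric one and a maximum
    principle.

    Geometry: M with its loops collapsed is an entire graph over the plane.
    Modulo the identification F is a local homeomorphism, near an interior point
    because X is spacelike ([interior_nice]) and near a loop because the
    singularity is conelike ([conelike_nice]); locally u changes at most as much
    as F.  Hence, while a segment of the plane is lifted through F, the lift stays
    in a bounded part of R^3, and by properness of X it does not escape: every
    segment lifts, and its end point depends continuously on its starting point
    ([lifts_stably_exists]).  The end points over a given point of the plane form
    a discrete set, so they are constant by connectedness of M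
    ([segment_lifting]).  Therefore F is injective modulo the identification and
    |u(q) - u(a)| <= |F(q) - F(a)| for all a, q in M ([entire_graph]), strictly
    when a and q are not identified.  Fix now a point a on some loop and let
    Z(q) = <X(q) - X(a), X(q) - X(a)> ([sqdist]).  Then Z vanishes on the loop of
    a and is positive elsewhere, and its sublevel sets in M are compact
    ([sqdist_proper]).

    Maximum principle: vanishing mean curvature makes the coordinates of X harmonic
    in conformal coordinates ([entry_harmonic]), so with conformal factor l one has
    Delta Z = 4 l > 0, while the reverse Bessel inequality of Lorentz space
    ([lorentz_bessel]) gives Z Delta Z <= |grad Z|^2.  Thus ln Z is superharmonic,
    positive and proper outside a neighbourhood of the loop of a.  For f bounded,
    harmonic and zero on the boundary, f - eps ln Z + eta Z has no interior local
    maximum where Z > 0 ([no_interior_max]).  Comparing on the compact sets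
    t <= Z <= s, and choosing t so small that f is small where Z < t, which is
    possible because Z vanishes only on a loop where f does, one gets f <= 0
    ([bounded_harmonic_le0]); the same holds for -f. *)

(** * Lifting segments through a proper local homeomorphism *)

(** The map F is studied modulo an equivalence relation E on M whose classes are
    contracted; neighbourhoods are taken of whole classes, so that no quotient
    space is needed.  The function u plays the role of the height, and N that of
    the Euclidean norm. *)
Section RadialLifting.
Context {R : realType} {T : topologicalType} {V : normedModType R}.
Variables (M : set T) (E : T -> T -> Prop) (F : T -> V) (u : T -> R) (N : V -> R).

(** A union of classes of E in M. *)
Definition saturated (K : set T) : Prop :=
  forall b c, K b -> M c -> E b c -> K c.

(** Injectivity of F on K up to E. *)
Definition injective_mod (K : set T) : Prop :=
  forall b c, K b -> K c -> F b = F c -> E b c.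

(** C is a compact neighbourhood, relative to M, of the class of a, with U an open
    set in between; on C the map F is injective modulo E, its image contains the
    ball of radius e, and the height satisfies a Lipschitz condition centred at
    a, strict off the class of a. *)
Record nice (a : T) (C U : set T) (e : R) : Prop := Nice {
  nice_compact : compact C;
  nice_sub : C `<=` M;
  nice_sat : saturated C;
  nice_inj : injective_mod C;
  nice_open : open U;
  nice_class : forall b, M b -> E a b -> U b;
  nice_incl : U `&` M `<=` C;
  nice_osat : saturated (U `&` M);
  nice_gt0 : 0 < e;
  nice_surj : forall y, `|y - F a| < e -> exists2 c, C c & F c = y;
  nice_lip : forall b, C b -> `|u b - u a| <= N (F b - F a);
  nice_slip : forall b, C b -> ~ E a b -> `|u b - u a| < N (F b - F a) }.

(** The point of parameter t on the segment from p to x. *)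
Definition seg (p x : V) (t : R) : V := p + t *: (x - p).

(** K is a lift, starting at q and ending at a, of the part of the segment from
    p to F q with parameters between t and 1. *)
Record lift (p : V) (K : set T) (t : R) (q a : T) : Prop := Lift {
  lift_compact : compact K;
  lift_sub : K `<=` M;
  lift_sat : saturated K;
  lift_inj : injective_mod K;
  lift_start : K q;
  lift_end : K a;
  lift_endE : F a = seg p (F q) t;
  lift_range : forall b, K b -> exists2 s, t <= s <= 1 & F b = seg p (F q) s;
  lift_onto : forall s, t <= s <= 1 -> exists2 b, K b & F b = seg p (F q) s }.

Hypotheses (hT : hausdorff_space T) (hM : connected M).
Hypotheses (Erefl : forall a, M a -> E a a)
  (Esym : forall a b, E a b -> E b a)
  (Etrans : forall a b c, E a b -> E b c -> E a c)
  (FE : forall a b, E a b -> F a = F b)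
  (uE : forall a b, E a b -> u a = u b).
Hypothesis Fc : continuous F.
Hypothesis NZ : forall s x, N (s *: x) = `|s| * N x.
Hypothesis hnice : forall a, M a -> exists C U e, nice a C U e.
Hypothesis hproper : forall B, 
  compact (M `&` [set q | `|F q| <= B /\ `|u q| <= B]).

Lemma seg1 p x : seg p x 1 = x.
Proof. by rewrite /seg scale1r addrC subrK. Qed.

Lemma seg0 p x : seg p x 0 = p.
Proof. by rewrite /seg scale0r addr0. Qed.

Lemma segB p x s t : seg p x s - seg p x t = (s - t) *: (x - p).
Proof. by rewrite /seg scalerBl opprD addrACA subrr add0r. Qed.

Lemma segBx p x y s : seg p x s - seg p y s = s *: (x - y).
Proof.
rewrite /seg opprD addrACA subrr add0r -scalerBr; congr (_ *: _).
by rewrite opprB addrA subrK.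
Qed.

Lemma seg_eq p x s t : seg p x s = seg p x t -> s = t \/ x = p.
Proof.
move=> /eqP; rewrite -subr_eq0 segB scaler_eq0 !subr_eq0 => /orP[/eqP|/eqP].
  by left.
by right.
Qed.

Lemma segpp p s : seg p p s = p.
Proof. by rewrite /seg subrr scaler0 addr0. Qed.

Lemma seg_continuous p x : continuous (seg p x).
Proof.
move=> t; apply: cvgD; first exact: cvg_cst.
by apply: cvgZr_tmp; exact: cvg_id.
Qed.

(** The points of a compact set whose values are close to y lie in any given
    neighbourhood of the fibre over y. *)
Lemma compact_fibre_nbhs (C W : set T) (y : V) :
  compact C -> open W -> (forall c, C c -> F c = y -> W c) ->
  exists2 e : R, 0 < e & forall c, C c -> `|F c - y| < e -> W c.
Proof.
move=> cC oW CW.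
have cl : closed (F @` (C `&` ~` W)).
  apply: compact_closed; first exact: norm_hausdorff.
  apply: continuous_compact; first exact: continuous_subspaceT.
  by apply: compact_closedI => //; exact: open_closedC.
have : nbhs y (~` (F @` (C `&` ~` W))).
  apply: open_nbhs_nbhs; split; first exact: closed_openC.
  by move=> -[c [Cc nWc] Fcy]; apply: nWc; exact: CW.
move=> /nbhs_ballP[e /= e0 he]; exists e => // c Cc ce.
apply: contrapT => nWc; apply: (he (F c)); last by exists c.
by rewrite -ball_normE /= distrC.
Qed.

Lemma closed_fibre_seg p x s t :
  closed (F @^-1` [set seg p x r | r in `[s, t]]).
Proof.
apply: preimage_closed; first by move=> z _; exact: Fc.
apply: compact_closed; first exact: norm_hausdorff.
apply: continuous_compact; last exact: segment_compact.
by apply: continuous_subspaceT; exact: seg_continuous.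
Qed.

Lemma saturatedI_fibre K p x s t : saturated K ->
  saturated (K `&` F @^-1` [set seg p x r | r in `[s, t]]).
Proof.
move=> sK b c [Kb [r rst Fb]] Mc bc; split; first exact: sK bc.
by exists r => //; rewrite Fb; exact: FE.
Qed.

(** Inside a compact set on which F is injective, a lift is a preimage. *)
Lemma lift_nice p t q C :
  compact C -> C `<=` M -> saturated C -> injective_mod C -> C q -> t <= 1 ->
  (forall s, t <= s <= 1 -> exists2 b, C b & F b = seg p (F q) s) ->
  forall a, C a -> F a = seg p (F q) t ->
  lift p (C `&` F @^-1` [set seg p (F q) r | r in `[t, 1]]) t q a.
Proof.
move=> cC CM sC iC Cq t1 h a Ca Fa; split.
- by apply: compact_closedI => //; exact: closed_fibre_seg.
- by move=> b [/CM].
- exact: saturatedI_fibre.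
- by move=> b c [Cb _] [Cc _]; exact: iC.
- by split=> //; exists 1; rewrite /= ?in_itv/= ?t1 ?lexx// seg1.
- by split=> //; exists t; rewrite /= ?in_itv/= ?t1 ?lexx.
- by [].
- by move=> b [_ [s]]; rewrite /= in_itv/= => st <-; exists s.
- move=> s st; have [b Cb Fb] := h s st; exists b => //; split => //.
  by exists s; rewrite /= ?in_itv.
Qed.

(** Concatenation of a lift down to the parameter t with a piece of segment
    lifted inside a set C on which F is injective. *)
Lemma lift_glue p K t t' q a C a' : lift p K t q a ->
  compact C -> C `<=` M -> saturated C -> injective_mod C -> C a ->
  t' <= t -> t <= 1 ->
  (forall s, t' <= s <= t -> exists2 b, C b & F b = seg p (F q) s) ->
  C a' -> F a' = seg p (F q) t' ->
  exists K', lift p K' t' q a'.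
Proof.
move=> L cC CM sC iC Ca tt t1 h Ca' Fa'.
pose K' := C `&` F @^-1` [set seg p (F q) r | r in `[t', t]].
(* A common value of the two pieces can only be the one at the parameter t,
   or the segment is reduced to a point; in both cases it is F a. *)
have cross b c : K b -> K' c -> F b = F c -> E b c.
  move=> Kb [Cc [s]]; rewrite /= in_itv/= => /andP[t's st] Fc' Fbc.
  have [r /andP[tr r1] Fb] := lift_range L Kb.
  suff Fba : F b = F a.
    apply: (Etrans (b := a)); first exact: (lift_inj L Kb (lift_end L)).
    by apply: iC => //; rewrite -Fba.
  rewrite (lift_endE L) Fb; move: Fbc; rewrite Fb -Fc' => /seg_eq[rs|->].
    by congr seg; apply/eqP; rewrite eq_le tr rs st.
  by rewrite !segpp.
exists (K `|` K'); split.
- apply: compactU; first exact: lift_compact L.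
  by apply: compact_closedI => //; exact: closed_fibre_seg.
- by move=> b [/(lift_sub L)//|[/CM]].
- move=> b c [Kb|Kb] Mc bc; first by left; exact: (lift_sat L) bc.
  by right; apply: (saturatedI_fibre sC) bc.
- move=> b c [Kb|Kb] [Kc|Kc] Fbc.
  + exact: (lift_inj L).
  + exact: cross.
  + by apply: Esym; apply: cross.
  + by apply: iC => //; [case: Kb|case: Kc].
- by left; exact: lift_start L.
- by right; split => //; exists t'; rewrite /= ?in_itv/= ?tt ?lexx.
- by [].
- move=> b [Kb|[Cb [s]]].
    have [s /andP[ts s1] Fb] := lift_range L Kb.
    by exists s => //; rewrite s1 (le_trans tt ts).
  rewrite /= in_itv/= => /andP[ts s1] <-; exists s => //.
  by rewrite ts (le_trans s1 t1).
- move=> s /andP[ts s1]; have [st|/ltW st] := leP t s.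
    have [|b Kb Fb] := lift_onto L (s := s); first by rewrite st.
    by exists b => //; left.
  have [|b Cb Fb] := h s; first by rewrite ts.
  by exists b => //; right; split=> //; exists s; rewrite /= ?in_itv/= ?ts.
Qed.

(** Two lifts of a segment from the same point agree along the whole segment: the
    parameters of the points of their intersection form an open and closed subset
    of [0, 1]. *)
Lemma lift_unique p q K K' a a' :
  lift p K 0 q a -> lift p K' 0 q a' -> E a a'.
Proof.
move=> L L'.
pose S := [set s : R | s \in `[0, 1] /\ exists2 b, K b /\ K' b & F b = seg p (F q) s].
have cKK : compact (K `&` K').
  apply: compact_closedI; first exact: lift_compact L.
  by apply: compact_closed => //; exact: lift_compact L'.
have SE : S = [set` `[0, 1]].
  apply: (@segment_connected R 0 1).
  - exists 1; split; first by rewrite /= in_itv/= ler01 lexx.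
    exists q; first by split; [exact: lift_start L|exact: lift_start L'].
    by rewrite seg1.
  - exists (interior [set s | s \in `[0, 1] -> S s]); first exact: open_interior.
    apply/seteqP; split=> s; last by case=> s01 /interior_subset/(_ s01).
    move=> [s01 [b [Kb K'b] Fb]]; split=> //.
    have [C [U [e H]]] := hnice (lift_sub L Kb).
    have sub J c : saturated J -> injective_mod J -> J `<=` M -> J b -> J c ->
        F c = seg p (F q) s -> U c.
      move=> sJ iJ JM Jb Jc Fc'; apply: (nice_class H); first exact: JM.
      by apply: iJ => //; rewrite Fb.
    have [d d0 hd] := compact_fibre_nbhs (lift_compact L) (nice_open H)
      (fun c Kc => sub K c (lift_sat L) (lift_inj L) (lift_sub L) Kb Kc).
    have [d' d'0 hd'] := compact_fibre_nbhs (lift_compact L') (nice_open H)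
      (fun c Kc => sub K' c (lift_sat L') (lift_inj L') (lift_sub L') K'b Kc).
    have near_s r : 0 < r -> \forall s' \near s,
        `|seg p (F q) s' - seg p (F q) s| < r.
      move=> r0; have /cvgr_dist_lt/(_ r r0) := @seg_continuous p (F q) s.
      by apply: filterS => s'; rewrite distrC.
    rewrite /interior /=; near=> s' => s'01; split=> //.
    have s'I : 0 <= s' <= 1 by move: s'01; rewrite in_itv.
    have [c Kc Fc'] := lift_onto L s'I.
    have [c' Kc' Fc''] := lift_onto L' s'I.
    have Mc := lift_sub L Kc; have Mc' := lift_sub L' Kc'.
    exists c => //; split=> //; apply: (lift_sat L' Kc') => //.
    apply: (nice_inj H); last by rewrite Fc' Fc''.
      apply: (nice_incl H); split=> //; apply: hd' => //; rewrite Fc''.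
      by near: s'; exact: near_s.
    apply: (nice_incl H); split=> //; apply: hd => //; rewrite Fc'.
    by near: s'; exact: near_s.
  - exists (seg p (F q) @^-1` (F @` (K `&` K'))).
      apply: preimage_closed; first by move=> z _; exact: seg_continuous.
      apply: compact_closed; first exact: norm_hausdorff.
      by apply: continuous_compact => //; exact: continuous_subspaceT.
    apply/seteqP; split=> s.
      by move=> [s01 [b Kb Fb]]; split=> //; exists b.
    by move=> [s01 [b [Kb K'b] Fb]]; split=> //; exists b.
have : S 0 by rewrite SE /= in_itv/= lexx ler01.
move=> [_ [b [Kb K'b] Fb]]; apply: (Etrans (b := b)).
  by apply: (lift_inj L _ Kb); [exact: lift_end L|rewrite Fb (lift_endE L)].
by apply: (lift_inj L' K'b); [exact: lift_end L'|rewrite Fb (lift_endE L')].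
Unshelve. all: by end_near.
Qed.

(** The segment from F q to p lifts down to the parameter t with end point a; the
    last clause says that the end point of the lift depends continuously, modulo
    E, on the starting point. *)
Definition lifts_stably (p : V) (q : T) (t : R) (a : T) : Prop :=
  [/\ exists K, lift p K t q a,
      `|u a - u q| <= (1 - t) * N (F q - p) &
      forall W : set T, open W -> (forall b, M b -> E a b -> W b) ->
        \forall q' \near q, M q' ->
          exists2 a', W a' & exists K, lift p K t q' a'].

Lemma lifts_stably_start p q : M q -> lifts_stably p q 1 q.
Proof.
have base q' : M q' -> exists K, lift p K 1 q' q'.
  move=> Mq'; have [C [U [e H]]] := hnice Mq'.
  have Cq : C q'.
    by apply: (nice_incl H); split=> //; apply: (nice_class H) => //; exact: Erefl.
  eexists; apply: (lift_nice (nice_compact H) (nice_sub H) (nice_sat H)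
    (nice_inj H) Cq _ _ (a := q')) => //; last by rewrite seg1.
  move=> s s1; exists q' => //; rewrite -[s](_ : 1 = s) ?seg1//.
  by apply/eqP; rewrite eq_le.
move=> Mq; split; first exact: base.
  by rewrite !subrr normr0 mul0r.
move=> W oW EW; have : nbhs q W.
  by apply: open_nbhs_nbhs; split=> //; apply: EW => //; exact: Erefl.
by apply: filterS => q' Wq' Mq'; exists q' => //; exact: base.
Qed.

Lemma seg_near_ball p x y t s e : 0 <= s <= 1 -> 0 < e ->
  `|seg p x s - seg p x t| < e / 2 -> `|y - x| < e / 2 ->
  `|seg p y s - seg p x t| < e.
Proof.
move=> /andP[s0 s1] e0 h1 h2.
rewrite -(subrKA (seg p x s)) (le_lt_trans (ler_normD _ _))//.
rewrite [e]splitr ltrD// segBx normrZ ger0_norm//.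
by rewrite (le_lt_trans _ h2)// ler_piMl.
Qed.

(** A stable lift whose end enters a nice neighbourhood can be continued across
    it. The height satisfies a Lipschitz condition centred at a0, which will be a
    cluster point of ends of lifts; hence the hypothesis t' <= t0 <= t. *)
Lemma lifts_stably_step p q t t0 t' a a0 C U e :
  M q -> nice a0 C U e -> F a0 = seg p (F q) t0 -> U a ->
  lifts_stably p q t a -> 0 <= t' -> t' <= t0 -> t0 <= t -> t <= 1 ->
  (forall s, t' <= s <= t -> `|seg p (F q) s - seg p (F q) t0| < e / 2) ->
  exists a', lifts_stably p q t' a'.
Proof.
move=> Mq H Fa0 Oa [[K L] lip stab] t'0 t't0 t0t t1 hs.
have e0 := nice_gt0 H.
have t't : t' <= t := le_trans t't0 t0t.
have t0I : 0 <= t0 := le_trans t'0 t't0.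
have onto y : `|y - F q| < e / 2 -> forall s, t' <= s <= t ->
    exists2 b, C b & F b = seg p y s.
  move=> yq s st; apply: (nice_surj H); rewrite Fa0.
  apply: seg_near_ball => //; last exact: hs.
  by move: st => /andP[ts st]; rewrite (le_trans t'0 ts) (le_trans st t1).
have e20 : 0 < e / 2 by rewrite divr_gt0.
have Ma : M a := lift_sub L (lift_end L).
have Ca : C a by apply: (nice_incl H).
have t'I : t' <= t' <= t by rewrite lexx.
have [|a' Ca' Fa'] := onto (F q) _ t' t'I; first by rewrite subrr normr0.
exists a'; split.
- apply: (lift_glue L (nice_compact H) (nice_sub H) (nice_sat H) (nice_inj H)
    Ca t't t1) => //.
  by apply: onto; rewrite subrr normr0.
- have := nice_lip H Ca'; have := nice_lip H Ca.
  rewrite Fa' Fa0 (lift_endE L) !segB !NZ => h1 h2.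
  rewrite -(subrKA (u a)) (le_trans (ler_normD _ _))//.
  rewrite -(subrKA (u a0)) (le_trans (lerD (ler_normD _ _) lip))//.
  rewrite (distrC (u a0)) (le_trans (lerD (lerD h2 h1) (lexx _)))//.
  rewrite ler0_norm ?subr_le0// ger0_norm ?subr_ge0// -!mulrDl.
  by rewrite le_eqVlt; apply/orP; left; apply/eqP; congr (_ * _); ring.
- move=> W oW EW.
  have [|d d0 hd] := compact_fibre_nbhs (C := C) (y := F a') (nice_compact H) oW.
    move=> c Cc Fca; apply: EW; first exact: (nice_sub H).
    exact: (nice_inj H).
  have stabO := stab U (nice_open H).
  have {}stabO : \forall q' \near q, M q' ->
      exists2 a', U a' & exists K, lift p K t q' a'.
    apply: stabO => b Mb ab.
    by have [] : (U `&` M) b by apply: (nice_osat H) ab.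
  have nearF r : 0 < r -> \forall q' \near q, `|F q' - F q| < r.
    move=> r0; have /cvgr_dist_lt/(_ r r0) := @Fc q.
    by apply: filterS => q'; rewrite distrC.
  near=> q' => Mq'.
  have q'e : `|F q' - F q| < e / 2 by near: q'; exact: nearF.
  have /(_ Mq')[b Ob [Kb Lb]] :
      M q' -> exists2 a', U a' & exists K, lift p K t q' a' by near: q'.
  have Cb : C b.
    by apply: (nice_incl H); split => //; exact: (lift_sub Lb (lift_end Lb)).
  have [b' Cb' Fb'] := onto _ q'e t' t'I.
  exists b'.
    apply: hd => //; rewrite Fb' Fa' segBx normrZ ger0_norm//.
    have q'd : `|F q' - F q| < d by near: q'; exact: nearF.
    rewrite (le_lt_trans _ q'd)// ler_piMl//.
    by rewrite (le_trans t't0)// (le_trans t0t).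
  apply: (lift_glue Lb (nice_compact H) (nice_sub H) (nice_sat H) (nice_inj H)
    Cb t't t1) => //.
  exact: onto.
Unshelve. all: by end_near.
Qed.

(** Let t0 be the infimum of the parameters down to which the segment lifts. The
    ends of the lifts stay in a compact set by properness, and lifting continues
    across a nice neighbourhood of one of their cluster points, so t0 = 0. *)
Lemma lifts_stably_exists p q : M q -> exists a, lifts_stably p q 0 a.
Proof.
move=> Mq; pose S := [set t : R | 0 <= t <= 1 /\ exists a, lifts_stably p q t a].
have S1 : S 1.
  by split; [rewrite ler01 lexx|exists q; exact: lifts_stably_start].
have S0 t : S t -> 0 <= t by case=> /andP[].
have hinf : has_inf S by split; [exists 1|exists 0; exact: S0].
pose t0 := inf S.
have t0_ge0 : 0 <= t0 by apply: lb_le_inf; [exists 1|exact: S0].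
have /choice[ta hta] : forall n : nat, exists ta : R * T,
    [/\ 0 <= ta.1 <= 1, lifts_stably p q ta.1 ta.2 & ta.1 < t0 + n.+1%:R^-1].
  move=> n; have [|t [t01 [a La]] tlt] := @inf_adherent R S n.+1%:R^-1 _ hinf.
    by rewrite invr_gt0.
  by exists (t, a).
pose x : R := `|F q - p|.
have t0_le n : t0 <= (ta n).1.
  by apply: ge_inf; [exists 0|have [? ? _] := hta n; split => //; exists (ta n).2].
have near_t0 d : 0 < d -> \forall n \near \oo, (ta n).1 < t0 + d.
  move=> d0; near=> n; have [_ _ /lt_le_trans->//] := hta n.
  rewrite lerD2l; apply: ltW; near: n.
  exact: near_infty_natSinv_lt (PosNum d0).
have Fta n : F (ta n).2 = seg p (F q) (ta n).1.
  by have [_ [[K L] _ _] _] := hta n; exact: lift_endE L.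
pose B : R := `|p| + x + `|u q| + `|N (F q - p)|.
have BP n : (M `&` [set q | `|F q| <= B /\ `|u q| <= B]) (ta n).2.
  have [/andP[t_ge0 t_le1] [[K L] lip _] _] := hta n.
  split; first exact: (lift_sub L (lift_end L)).
  split.
    rewrite Fta /seg (le_trans (ler_normD _ _))// normrZ ger0_norm//.
    have : (ta n).1 * x <= x by rewrite ler_piMl// normr_ge0.
    by rewrite /B -/x; have := normr_ge0 (u q); have := normr_ge0 (N (F q - p)); lra.
  have : `|u (ta n).2| <= `|u (ta n).2 - u q| + `|u q|.
    by rewrite -{1}(subrK (u q) (u _)) ler_normD.
  have : (1 - (ta n).1) * N (F q - p) <= `|N (F q - p)|.
    rewrite (le_trans (ler_norm _))// normrM ger0_norm ?subr_ge0//.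
    by rewrite ler_piMl// lerBlDr lerDl.
  have : 0 <= x by exact: normr_ge0.
  by rewrite /B; have := normr_ge0 p; lra.
have FB : \forall n \near \oo,
    (M `&` [set q | `|F q| <= B /\ `|u q| <= B]) (ta n).2.
  by near=> n; exact: BP.
have [a0 [[Ma0 _] cla0]] := @hproper B ((ta n).2 @[n --> \oo]) _ FB.
have close e : 0 < e ->
    exists2 d, 0 < d & forall s, `|s - t0| < d -> `|seg p (F q) s - seg p (F q) t0| < e.
  move=> e0; exists (e / (x + 1)).
    by rewrite divr_gt0// ltr_wpDl// normr_ge0.
  move=> s sd; rewrite segB normrZ -/x.
  have x0 : 0 <= x by exact: normr_ge0.
  move: sd; rewrite ltr_pdivlMr ?ltr_wpDl// => /le_lt_trans; apply.
  by rewrite ler_wpM2l// lerDl.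
have Fa0 : F a0 = seg p (F q) t0.
  apply/eqP; rewrite -subr_eq0 -normr_eq0; apply/eqP/le_anti.
  rewrite normr_ge0 andbT; apply/ler_addgt0Pl => e e0; rewrite addr0.
  have [|d d0 hd] := close (e / 2); first by rewrite divr_gt0.
  have nbF : nbhs a0 [set b | `|F a0 - F b| < e / 2].
    by have /cvgr_dist_lt := @Fc a0; apply; rewrite divr_gt0.
  have nbt : \forall n \near \oo,
      [set b | `|F b - seg p (F q) t0| < e / 2] (ta n).2.
    near=> n; rewrite /= Fta; apply: hd; rewrite ger0_norm ?subr_ge0//.
    by rewrite ltrBlDl; near: n; exact: near_t0.
  have [b [h1 h2]] := cla0 _ _ nbt nbF.
  rewrite -(subrKA (F b)) (le_trans (ler_normD _ _))// ltW//.
  by rewrite [e]splitr ltrD.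
have [C [U [e H]]] := hnice Ma0.
have [|d d0 hd] := close (e / 2); first by rewrite divr_gt0// (nice_gt0 H).
have nbU : nbhs a0 U.
  apply: open_nbhs_nbhs; split; first exact: nice_open H.
  by apply: (nice_class H) => //; exact: Erefl.
have nbt : \forall n \near \oo, [set b | exists2 t,
    [/\ 0 <= t <= 1, t0 <= t & t < t0 + d] & lifts_stably p q t b] (ta n).2.
  near=> n; have [t01 L _] := hta n; exists (ta n).1 => //; split=> //.
  by near: n; exact: near_t0.
have [a [[t [/andP[t_ge0 t_le1] t0t td] La] Ua]] := cla0 _ _ nbt nbU.
pose t' := Num.max 0 (t0 - d / 2).
have t't0 : t' <= t0 by rewrite ge_max t0_ge0/= gerBl divr_ge0// ltW.
have t'0 : 0 <= t' by rewrite le_max lexx.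
have d20 : 0 < d / 2 by rewrite divr_gt0.
have t'd : t0 - d < t' by rewrite lt_max; apply/orP; right; lra.
have [|a' La'] := @lifts_stably_step p q t t0 t' a a0 C U e Mq H Fa0 Ua La t'0 t't0 t0t t_le1.
  move=> s /andP[t's st]; apply: hd; rewrite ltr_norml.
  by apply/andP; split; lra.
have : t0 <= t'.
  apply: ge_inf; first by exists 0.
  split; last by exists a'.
  by rewrite t'0 (le_trans t't0)// (le_trans t0t).
rewrite /t' le_max => /orP[t0le|]; last by rewrite lerBrDr gerDl leNgt d20.
suff t'00 : t' = 0 by exists a'; rewrite -t'00.
by apply/le_anti; rewrite t'0 andbT (le_trans t't0).
Unshelve. all: by end_near.
Qed.

(** The segment from F q to F a lifts from q to a: for fixed a, the class of the end
    point of the lift is locally constant in q, hence constant by connectedness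
    of M. *)
Theorem segment_lifting a q : M a -> M q ->
  `|u q - u a| <= N (F q - F a) /\ exists K, lift (F a) K 0 q a.
Proof.
move=> Ma Mq; pose p := F a.
pose G := [set q | M q /\ exists K, lift p K 0 q a].
have liftE b c K : lift p K 0 b c -> M a -> E c a -> lift p K 0 b a.
  move=> L _ ca; case: (L) => *; split=> //; first exact: (lift_sat L (lift_end L)).
  by rewrite -(FE ca) (lift_endE L).
have over0 c d C U e : nice d C U e -> M d -> U c -> M c -> F c = p -> F d = p -> E c d.
  move=> H Md Uc Mc Fcp Fdp; apply: (nice_inj H); last by rewrite Fcp.
    by apply: (nice_incl H); split.
  by apply: (nice_incl H); split=> //; apply: (nice_class H) => //; exact: Erefl.
have Fend b c K : lift p K 0 b c -> F c = p.
  by move=> L; rewrite (lift_endE L) seg0.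
have stab b : M b -> exists2 c, [/\ M c, F c = p & exists K, lift p K 0 b c] &
    \forall b' \near b, M b' -> exists2 K, True & lift p K 0 b' c.
  move=> Mb; have [c [[K L] _ st]] := lifts_stably_exists p Mb.
  have Mc := lift_sub L (lift_end L).
  exists c; first by split=> //; [exact: Fend L|exists K].
  have [C [U [e H]]] := hnice Mc.
  have := st U (nice_open H) (nice_class H); apply: filterS => b' hb' Mb'.
  have [c' Uc' [K' L']] := hb' Mb'; exists K' => //.
  have Mc' := lift_sub L' (lift_end L').
  have c'c : E c' c := over0 _ _ _ _ _ H Mc Uc' Mc' (Fend _ _ _ L') (Fend _ _ _ L).
  case: (L') => *; split=> //; first exact: (lift_sat L' (lift_end L')).
  by rewrite -(FE c'c) (lift_endE L').
have GM : G = M.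
  apply: hM.
  - have [C [U [e H]]] := hnice Ma.
    have Ca : C a.
      apply: (nice_incl H); split=> //; apply: (nice_class H) => //.
      exact: Erefl.
    exists a; split=> //; eexists; apply: (lift_nice (nice_compact H) (nice_sub H)
      (nice_sat H) (nice_inj H) Ca) => //.
      by move=> s _; exists a => //; rewrite segpp.
    by rewrite segpp.
  - exists (interior [set b | M b -> G b]); first exact: open_interior.
    apply/seteqP; split=> b; last by case=> Mb /interior_subset; exact.
    move=> [Mb [K L]]; split=> //.
    have [c [Mc Fcp [K' L']]] := stab b Mb.
    apply: filterS => b' hb' Mb'; split=> //.
    have [K'' _ L''] := hb' Mb'; exists K''; apply: liftE L'' Ma _.
    exact: lift_unique L' L.
  - exists (~` (interior [set b | M b -> ~ G b])).
      exact/open_closedC/open_interior.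
    apply/seteqP; split=> b.
      move=> Gb; case: (Gb) => Mb _; split=> // /interior_subset; exact.
    move=> [Mb nb]; apply: contrapT => nGb; apply: nb.
    have [c [Mc Fcp [K' L']]] := stab b Mb.
    apply: filterS => b' hb' Mb' [_ [K L]]; apply: nGb; split=> //.
    have [K'' _ L''] := hb' Mb'; exists K'; apply: liftE L' Ma _.
    exact: lift_unique L'' L.
have : G q by rewrite GM.
move=> [_ [K L]]; split; last by exists K.
have [c [[K' L'] lip _]] := lifts_stably_exists p Mq.
move: lip; rewrite subr0 mul1r distrC.
by rewrite (uE (lift_unique L' L)).
Qed.
End RadialLifting.

(** * Calculus in the plane *)

Section PlaneCalculus.
Context {R : realType}.
Implicit Types (g : R * R -> R) (D : set (R * R)) (p q : R * R).

(** g is of class C^1 on D with partial derivatives g1 and g2. *)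
Definition C1_with D g g1 g2 : Prop := forall p, D p ->
  [/\ is_derive p e1 g (g1 p), is_derive p e2 g (g2 p),
      {for p, continuous g1}, {for p, continuous g2} & {for p, continuous g}].

(** The open ball of the maximum norm. *)
Definition box p (r : R) : set (R * R) :=
  [set q | `|q.1 - p.1| < r /\ `|q.2 - p.2| < r].

Lemma nbhs_boxP p (A : set (R * R)) :
  nbhs p A <-> exists2 r, 0 < r & box p r `<=` A.
Proof.
have boxE r : box p r = ball p r.
  rewrite predeqE => q; rewrite -ball_normE /ball_ /= prod_normE gt_max.
  by rewrite /box /= ![ `|_ - q.1|]distrC ![ `|_ - q.2|]distrC; split=> /andP.
split=> [/nbhs_ballP[r r0 rA]|[r r0 rA]].
  by exists r => //; rewrite boxE.
by apply/nbhs_ballP; exists r => //; rewrite -boxE.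
Qed.

Lemma nbhs_box p r : 0 < r -> nbhs p (box p r).
Proof. by move=> r0; apply/nbhs_boxP; exists r. Qed.

(** The restriction of g to the line p + s e. *)
Lemma is_derive_line (g : R * R -> R) p e (s a : R) :
  is_derive (p + s *: e) e g a -> is_derive s 1 (fun s => g (p + s *: e)) a.
Proof.
move=> [dg <-].
have E : (fun h : R => h^-1 *: (((fun s => g (p + s *: e)) \o shift s) (h *: 1) -
    g (p + s *: e))) = (fun h => h^-1 *: ((g \o shift (p + s *: e)) (h *: e) -
    g (p + s *: e))).
  apply/funext => h /=; congr (_ *: (g _ - _)).
  by rewrite [h *: 1]mulr1 scalerDl addrCA.
by split; rewrite /derivable /derive E.
Qed.

Lemma is_derive_entry (x : R * R -> 'rV[R]_3) p e (j : 'I_3) :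
  derivable x p e -> is_derive p e (fun q => x q 0 j) (('D_e x p) 0 j).
Proof.
move=> dx; split; first by move/derivable_mxP: dx; apply.
by rewrite derive_mx// mxE.
Qed.

Lemma mean_value_le (h dh : R -> R) (a b : R) : a <= b ->
  (forall s, a <= s <= b -> is_derive s 1 h (dh s)) ->
  exists2 s, a <= s <= b & h b - h a = dh s * (b - a).
Proof.
move=> ab H; have [|//|s sI hs] := @MVT_segment R h dh a b ab.
- by move=> s; rewrite in_itv/= => /andP[/ltW ? /ltW ?]; apply: H; apply/andP.
- apply: derivable_within_continuous => s; rewrite in_itv/= => sab.
  by have [] := H s sab.
- by exists s => //; move: sI; rewrite in_itv.
Qed.

Lemma mean_value (h dh : R -> R) (a b : R) :
  (forall s, Num.min a b <= s <= Num.max a b -> is_derive s 1 h (dh s)) ->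
  exists2 s, Num.min a b <= s <= Num.max a b & h b - h a = dh s * (b - a).
Proof.
have /orP[ab|ba] := le_total a b => H.
  by move: H; rewrite min_l// max_r//; exact: mean_value_le.
move: H; rewrite min_r// max_l// => /(mean_value_le ba)[s sI hs].
by exists s => //; rewrite -opprB hs -mulrN opprB.
Qed.

Lemma between_lt (a b c s r : R) : Num.min a b <= s <= Num.max a b ->
  `|a - c| < r -> `|b - c| < r -> `|s - c| < r.
Proof.
rewrite ge_min le_max => /andP[/orP[] ? /orP[] ?];
  rewrite !ltr_norml => /andP[? ?] /andP[? ?]; apply/andP; split; lra.
Qed.

(** The increment is split into a horizontal and a vertical one, so the partial
    derivatives are taken at two different points x and y. *)
Lemma mean_value_plane D g g1 g2 p r a b : C1_with D g g1 g2 ->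
  box p r `<=` D -> box p r a -> box p r b ->
  exists x y, [/\ box p r x, box p r y &
    g b - g a = (b.1 - a.1) * g1 x + (b.2 - a.2) * g2 y].
Proof.
move=> H rD [a1 a2] [b1 b2].
have E1 (s t : R) : (0, t) + s *: e1 = (s, t).
  by rewrite /e1; congr pair => /=; rewrite ?add0r ?[_ *: _]mulr1 ?[_ *: _]mulr0 ?addr0.
have E2 (s t : R) : (s, 0) + t *: e2 = (s, t).
  by rewrite /e2; congr pair => /=; rewrite ?add0r ?[_ *: _]mulr1 ?[_ *: _]mulr0 ?addr0.
have [|s sI hs] := @mean_value (fun s => g (s, a.2)) (fun s => g1 (s, a.2)) a.1 b.1.
  move=> s sI; have [|d _ _ _ _] := H (s, a.2).
    by apply: rD; split=> //=; exact: between_lt sI _ _.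
  under eq_fun do rewrite -E1.
  by apply: is_derive_line; rewrite E1.
have [|t tI ht] := @mean_value (fun t => g (b.1, t)) (fun t => g2 (b.1, t)) a.2 b.2.
  move=> t tI; have [|_ d _ _ _] := H (b.1, t).
    by apply: rD; split=> //=; exact: between_lt tI _ _.
  under eq_fun do rewrite -E2.
  by apply: is_derive_line; rewrite E2.
exists (s, a.2), (b.1, t); split.
- by split=> //=; exact: between_lt sI _ _.
- by split=> //=; exact: between_lt tI _ _.
move: hs ht; case: a b {a1 a2 b1 b2 sI tI} => [a1 a2] [b1 b2] /= hs ht.
by rewrite -(subrKA (g (b1, a2))) hs ht; ring.
Qed.

Lemma near_box_lt g p e : {for p, continuous g} -> 0 < e ->
  exists2 r, 0 < r & forall q, box p r q -> `|g q - g p| < e.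
Proof.
move=> gc e0; have /nbhs_boxP[r r0 h] : \forall q \near p, `|g q - g p| < e.
  have /cvgr_dist_lt/(_ e e0) := gc.
  by apply: filterS => q; rewrite distrC.
by exists r => // q /h.
Qed.

Lemma sub_box p r r' : r' <= r -> box p r' `<=` box p r.
Proof. by move=> rr q [? ?]; split; exact: lt_le_trans rr. Qed.

Lemma is_derive_sub (h k : R -> R) (s a b : R) : is_derive s 1 h a ->
  is_derive s 1 k b -> is_derive s 1 (fun t => h t - k t) (a - b).
Proof. by move=> ? ?; exact: is_deriveB. Qed.

(** Symmetry of second derivatives: the second difference of g over a square is
    expressed through either mixed derivative at a point of the square. *)
Lemma mixed_partials D g g1 g2 g11 g12 g21 g22 p : open D -> D p ->
  C1_with D g g1 g2 -> C1_with D g1 g11 g12 -> C1_with D g2 g21 g22 ->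
  g12 p = g21 p.
Proof.
move=> oD Dp H H1 H2; apply/eqP; rewrite -subr_eq0 -normr_eq0.
apply/eqP/le_anti; rewrite normr_ge0 andbT.
apply/ler_addgt0Pl => e e0; rewrite addr0.
have [_ _ _ c12 _] := H1 p Dp; have [_ _ c21 _ _] := H2 p Dp.
have e20 : 0 < e / 2 by rewrite divr_gt0.
have [r1 r10 h1] := near_box_lt c12 e20.
have [r2 r20 h2] := near_box_lt c21 e20.
have /nbhs_boxP[r0 r00 rD] : nbhs p D by exact: open_nbhs_nbhs.
pose r := Num.min r0 (Num.min r1 r2).
have r_gt0 : 0 < r by rewrite !lt_min r00 r10.
have rr0 : r <= r0 by rewrite ge_min lexx.
have rr1 : r <= r1 by rewrite !ge_min lexx ?orbT.
have rr2 : r <= r2 by rewrite !ge_min lexx ?orbT.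
pose h := r / 2.
have h0 : 0 < h by rewrite divr_gt0.
have hr : h < r by rewrite /h; lra.
pose P s t : R * R := p + s *: e1 + t *: e2.
have PE s t : P s t = (p.1 + s, p.2 + t).
  rewrite /P /e1 /e2; congr pair => /=.
    by rewrite [s *: _]mulr1 [t *: _]mulr0 addr0.
  by rewrite [s *: _]mulr0 [t *: _]mulr1 addr0.
have PC s t : P s t = p + t *: e2 + s *: e1 by rewrite /P addrAC.
have Pbox s t : 0 <= s <= h -> 0 <= t <= h -> box p r (P s t).
  move=> /andP[s0 sh] /andP[t0 th]; rewrite PE; split=> /=; rewrite addrC addKr.
    by rewrite ger0_norm// (le_lt_trans sh).
  by rewrite ger0_norm// (le_lt_trans th).
have PD s t : 0 <= s <= h -> 0 <= t <= h -> D (P s t).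
  by move=> ? ?; apply/rD/(sub_box rr0); exact: Pbox.
have I0 : 0 <= (0 : R) <= h by rewrite lexx ltW.
have Ih : 0 <= h <= h by rewrite lexx ltW.
have D1 k k1 k2 t s : C1_with D k k1 k2 -> 0 <= s <= h -> 0 <= t <= h ->
    is_derive s 1 (fun s => k (P s t)) (k1 (P s t)).
  move=> K sI tI; under eq_fun do rewrite PC.
  apply: is_derive_line; rewrite -PC.
  by have [] := K _ (PD _ _ sI tI).
have D2 k k1 k2 t s : C1_with D k k1 k2 -> 0 <= s <= h -> 0 <= t <= h ->
    is_derive t 1 (fun t => k (P s t)) (k2 (P s t)).
  move=> K sI tI; apply: is_derive_line.
  by have [] := K _ (PD _ _ sI tI).
pose A := g (P h h) - g (P h 0) - (g (P 0 h) - g (P 0 0)).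
have [s [t [sI tI A12]]] : exists s t,
    [/\ 0 <= s <= h, 0 <= t <= h & A = g12 (P s t) * h * h].
  have dA s : 0 <= s <= h -> is_derive s 1 (fun s => g (P s h) - g (P s 0))
      (g1 (P s h) - g1 (P s 0)).
    by move=> sI; exact: is_derive_sub (D1 _ _ _ h s H sI Ih) (D1 _ _ _ 0 s H sI I0).
  have [s sI hs] := mean_value_le (ltW h0) dA.
  have [t tI ht] := mean_value_le (ltW h0) (fun t => D2 _ _ _ t s H1 sI).
  exists s, t; split=> //.
  by rewrite /A hs ht !subr0.
have [s' [t' [s'I t'I A21]]] : exists s t,
    [/\ 0 <= s <= h, 0 <= t <= h & A = g21 (P s t) * h * h].
  have dA v : 0 <= v <= h -> is_derive v 1 (fun t => g (P h t) - g (P 0 t))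
      (g2 (P h v) - g2 (P 0 v)).
    by move=> vI; exact: is_derive_sub (D2 _ _ _ v h H Ih vI) (D2 _ _ _ v 0 H I0 vI).
  have [t' t'I ht] := mean_value_le (ltW h0) dA.
  have [s' s'I hs] := mean_value_le (ltW h0) (fun s sI => D1 _ _ _ t' s H2 sI t'I).
  exists s', t'; split=> //.
  have -> : A = g (P h h) - g (P 0 h) - (g (P h 0) - g (P 0 0)) by rewrite /A; ring.
  by rewrite ht hs !subr0.
have hh : h * h != 0 by rewrite mulf_neq0// gt_eqF.
have E : g12 (P s t) = g21 (P s' t').
  by apply: (mulIf hh); rewrite [LHS]mulrA [RHS]mulrA -A12 -A21.
have := h1 _ (sub_box rr1 (Pbox _ _ sI tI)).
have := h2 _ (sub_box rr2 (Pbox _ _ s'I t'I)).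
rewrite E => b1 b2; rewrite -(subrKA (g21 (P s' t'))) (le_trans (ler_normD _ _))//.
by rewrite [e]splitr lerD// ltW// distrC.
Qed.
(** For a conformal pair of vectors P, Q of positive square l, the Lorentz form is
    positive on the combinations of any pair P', Q' that is componentwise d-close
    to it. *)
Lemma conformal_form_pos (l m d P1 P2 P3 Q1 Q2 Q3 P1' P2' P3' Q1' Q2' Q3' v w : R) :
  0 < l -> 0 <= m -> 0 < d -> d <= 1 -> 4 * (6 * m + 1) * d <= l ->
  P1 ^+ 2 + P2 ^+ 2 - P3 ^+ 2 = l -> Q1 ^+ 2 + Q2 ^+ 2 - Q3 ^+ 2 = l ->
  P1 * Q1 + P2 * Q2 - P3 * Q3 = 0 ->
  [/\ `|P1| <= m, `|P2| <= m & `|P3| <= m] ->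
  [/\ `|Q1| <= m, `|Q2| <= m & `|Q3| <= m] ->
  [/\ `|P1' - P1| < d, `|P2' - P2| < d & `|P3' - P3| < d] ->
  [/\ `|Q1' - Q1| < d, `|Q2' - Q2| < d & `|Q3' - Q3| < d] ->
  0 < v ^+ 2 + w ^+ 2 ->
  (v * P3' + w * Q3') ^+ 2 < (v * P1' + w * Q1') ^+ 2 + (v * P2' + w * Q2') ^+ 2.
Proof.
move=> l0 m0 d0 d1 dl hP hQ hPQ [p1 p2 p3] [q1 q2 q3] [p1' p2' p3'] [q1' q2' q3'] vw.
pose s := `|v| + `|w|.
have s0 : 0 <= s by rewrite addr_ge0.
have s2 : s ^+ 2 <= 2 * (v ^+ 2 + w ^+ 2).
  rewrite /s -(real_normK (num_real v)) -(real_normK (num_real w)).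
  have := sqr_ge0 (`|v| - `|w|); lra.
have lin (a b k : R) : 0 <= k -> `|a| <= k -> `|b| <= k -> `|v * a + w * b| <= k * s.
  move=> k0 ak bk; rewrite (le_trans (ler_normD _ _))// !normrM /s mulrDr.
  by rewrite lerD// mulrC ler_wpM2r.
have crossb (x y : R) : `|x| <= m * s -> `|y| <= d * s ->
    - (m * d * s ^+ 2) <= x * y /\ x * y <= m * d * s ^+ 2 /\ y ^+ 2 <= d ^+ 2 * s ^+ 2.
  move=> xm yd.
  have : `|x * y| <= m * d * s ^+ 2.
    have -> : m * d * s ^+ 2 = (m * s) * (d * s) by ring.
    by rewrite normrM ler_pM.
  rewrite ler_norml => /andP[? ?]; split=> //; split=> //.
  rewrite -(real_normK (num_real y)) -exprMn ler_pXn2r ?nnegrE//.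
  by rewrite mulr_ge0// ltW.
have dec (a b a' b' : R) : v * a' + w * b' = (v * a + w * b) + (v * (a' - a) + w * (b' - b)).
  by ring.
rewrite (dec P1 Q1 P1' Q1') (dec P2 Q2 P2' Q2') (dec P3 Q3 P3' Q3').
have [h1 [h1' h1'']] := crossb _ _ (lin _ _ _ m0 p1 q1) (lin _ _ _ (ltW d0) (ltW p1') (ltW q1')).
have [h2 [h2' h2'']] := crossb _ _ (lin _ _ _ m0 p2 q2) (lin _ _ _ (ltW d0) (ltW p2') (ltW q2')).
have [h3 [h3' h3'']] := crossb _ _ (lin _ _ _ m0 p3 q3) (lin _ _ _ (ltW d0) (ltW p3') (ltW q3')).
set y1 := v * (P1' - P1) + _ in h1 h1' h1'' *.
set y2 := v * (P2' - P2) + _ in h2 h2' h2'' *.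
set y3 := v * (P3' - P3) + _ in h3 h3' h3'' *.
have main : (v * P1 + w * Q1) ^+ 2 + (v * P2 + w * Q2) ^+ 2 - (v * P3 + w * Q3) ^+ 2 =
    l * (v ^+ 2 + w ^+ 2).
  transitivity (v ^+ 2 * (P1 ^+ 2 + P2 ^+ 2 - P3 ^+ 2) + w ^+ 2 * (Q1 ^+ 2 + Q2 ^+ 2 - Q3 ^+ 2)
    + 2 * v * w * (P1 * Q1 + P2 * Q2 - P3 * Q3)); first by ring.
  by rewrite hP hQ hPQ; ring.
set x1 := v * P1 + _ in main h1 h1' *.
set x2 := v * P2 + _ in main h2 h2' *.
set x3 := v * P3 + _ in main h3 h3' *.
have bound : (6 * m * d + d ^+ 2) * s ^+ 2 <= (l / 2) * (v ^+ 2 + w ^+ 2).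
  have h : 6 * m * d + d ^+ 2 <= l / 4.
    have : d ^+ 2 <= d by rewrite expr2 ler_piMl// ltW.
    lra.
  apply: (le_trans (y := l / 4 * s ^+ 2)); first by rewrite ler_wpM2r// sqr_ge0.
  have : l / 4 * s ^+ 2 <= l / 4 * (2 * (v ^+ 2 + w ^+ 2)).
    by rewrite ler_wpM2l// divr_ge0// ltW.
  lra.
have : 0 < l * (v ^+ 2 + w ^+ 2) by exact: mulr_gt0.
clearbody x1 x2 x3 y1 y2 y3; rewrite (sqrrD x1) (sqrrD x2) (sqrrD x3) => ?.
have := sqr_ge0 y1; have := sqr_ge0 y2.
move: bound; rewrite mulrDl; lra.
Qed.

(** A conformal spacelike map is, near each point, strictly spacelike on pairs of
    points. *)
Lemma spacelike_local D x1 x2 x3 a1 a2 a3 b1 b2 b3 p (l : R) : open D -> D p ->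
  C1_with D x1 a1 b1 -> C1_with D x2 a2 b2 -> C1_with D x3 a3 b3 -> 0 < l ->
  a1 p ^+ 2 + a2 p ^+ 2 - a3 p ^+ 2 = l -> b1 p ^+ 2 + b2 p ^+ 2 - b3 p ^+ 2 = l ->
  a1 p * b1 p + a2 p * b2 p - a3 p * b3 p = 0 ->
  exists r, [/\ 0 < r, box p r `<=` D & forall a b, box p r a -> box p r b -> a != b ->
    (x3 b - x3 a) ^+ 2 < (x1 b - x1 a) ^+ 2 + (x2 b - x2 a) ^+ 2].
Proof.
move=> oD Dp H1 H2 H3 l0 hP hQ hPQ.
pose m := `|a1 p| + `|a2 p| + `|a3 p| + (`|b1 p| + `|b2 p| + `|b3 p|).
have n1 := normr_ge0 (a1 p); have n2 := normr_ge0 (a2 p).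
have n3 := normr_ge0 (a3 p); have k1 := normr_ge0 (b1 p).
have k2 := normr_ge0 (b2 p); have k3 := normr_ge0 (b3 p).
have m0 : 0 <= m by rewrite !addr_ge0.
pose d := Num.min 1 (l / (4 * (6 * m + 1))).
have c0 : 0 < 4 * (6 * m + 1) by lra.
have d0 : 0 < d by rewrite lt_min ltr01 divr_gt0.
have d1 : d <= 1 by rewrite ge_min lexx.
have dl : 4 * (6 * m + 1) * d <= l.
  by rewrite mulrC -ler_pdivlMr// /d ge_min lexx orbT.
have [_ _ ca1 cb1 _] := H1 p Dp; have [_ _ ca2 cb2 _] := H2 p Dp.
have [_ _ ca3 cb3 _] := H3 p Dp.
have [r1 r10 h1] := near_box_lt ca1 d0; have [s1 s10 g1] := near_box_lt cb1 d0.
have [r2 r20 h2] := near_box_lt ca2 d0; have [s2 s20 g2] := near_box_lt cb2 d0.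
have [r3 r30 h3] := near_box_lt ca3 d0; have [s3 s30 g3] := near_box_lt cb3 d0.
have /nbhs_boxP[r0 r00 rD] : nbhs p D by exact: open_nbhs_nbhs.
pose r := \big[Num.min/r0]_(t <- [:: r1; s1; r2; s2; r3; s3]) t.
have rle t : t \in [:: r0; r1; s1; r2; s2; r3; s3] -> r <= t.
  rewrite /r !big_cons big_nil !inE => /or4P[|||/or4P[]] /eqP->;
    by rewrite !ge_min lexx ?orbT.
exists r; split.
- by rewrite /r !big_cons big_nil !lt_min r10 s10 r20 s20 r30 s30.
- by apply: subset_trans rD; apply: sub_box; apply: rle; rewrite !inE eqxx.
have rD' : box p r `<=` D.
  by apply: subset_trans rD; apply: sub_box; apply: rle; rewrite !inE eqxx.
move=> a b pa pb ab.
have [t1 [u1 [T1 U1 ->]]] := mean_value_plane H1 rD' pa pb.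
have [t2 [u2 [T2 U2 ->]]] := mean_value_plane H2 rD' pa pb.
have [t3 [u3 [T3 U3 ->]]] := mean_value_plane H3 rD' pa pb.
apply: (conformal_form_pos l0 m0 d0 d1 dl hP hQ hPQ).
- by split; rewrite /m; lra.
- by split; rewrite /m; lra.
- by split; [apply: h1|apply: h2|apply: h3]; apply: sub_box;
    first [exact: T1|exact: T2|exact: T3|apply: rle; rewrite !inE eqxx ?orbT].
- by split; [apply: g1|apply: g2|apply: g3]; apply: sub_box;
    first [exact: U1|exact: U2|exact: U3|apply: rle; rewrite !inE eqxx ?orbT].
rewrite lt_neqAle addr_ge0 ?sqr_ge0// andbT eq_sym paddr_eq0 ?sqr_ge0//.
rewrite !sqrf_eq0 !subr_eq0; apply: contraNN ab => /andP[/eqP h /eqP h'].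
by case: a b {pa pb} h h' => [? ?] [? ?] /= -> ->.
Qed.

Lemma is_derive_sumsq (h k : R -> R) (c d t a b : R) :
  is_derive t 1 h a -> is_derive t 1 k b ->
  is_derive t 1 (fun s => (h s - c) ^+ 2 + (k s - d) ^+ 2)
    (2 * ((h t - c) * a + (k t - d) * b)).
Proof.
move=> ha kb; apply: is_derive_eq.
by rewrite /GRing.scale /=; ring.
Qed.

Lemma continuous_sqrB (T : topologicalType) (h : T -> R) (c : R) (q : T) :
  {for q, continuous h} -> {for q, continuous (fun z => (h z - c) ^+ 2)}.
Proof.
move=> hc; have hB : {for q, continuous (fun z => h z - c)}.
  by apply: continuousB => //; exact: cst_continuous.
rewrite (_ : (fun z => _) = (fun z => (h z - c) * (h z - c))) //.
exact: (continuousM hB hB).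
Qed.

Lemma local_min_derive (h dh : R -> R) (r : R) : 0 < r ->
  (forall t : R, `|t| < r -> is_derive t 1 h (dh t)) ->
  (forall t : R, `|t| < r -> h 0 <= h t) -> dh 0 = 0.
Proof.
move=> r0 H hmin.
have I (t : R) : t \in `](- r), r[ -> `|t| < r by rewrite in_itv/= ltr_norml.
have D0 : is_derive (0 : R) 1 h 0.
  apply: (@derive1_at_min _ h (- r) r 0).
  - by rewrite (le_trans _ (ltW r0))// oppr_le0 ltW.
  - by move=> t /I/H[].
  - by rewrite in_itv/= oppr_lt0 r0.
  - by move=> t /I; exact: hmin.
have D1 : is_derive (0 : R) 1 h (dh 0) by apply: H; rewrite normr0.
by rewrite -(@derive_val _ _ _ _ _ _ _ D1) (@derive_val _ _ _ _ _ _ _ D0).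
Qed.

Lemma box_line p r e : 0 < r -> exists2 d, 0 < d & forall t, `|t| < d -> box p r (p + t *: e).
Proof.
move=> r0; have k0 : 0 < 1 + (`|e.1| + `|e.2|) by rewrite ltr_pwDl// addr_ge0.
exists (r / (1 + (`|e.1| + `|e.2|))); first by rewrite divr_gt0.
move=> t; rewrite ltr_pdivlMr// => tr.
have := normr_ge0 t; have e1 := normr_ge0 e.1; have e2 := normr_ge0 e.2 => t0.
have m1 := mulr_ge0 t0 e1; have m2 := mulr_ge0 t0 e2.
by split; rewrite /= addrC addKr normrM; move: tr; rewrite !mulrDr mulr1; lra.
Qed.

(** The closed ball of the maximum norm. *)
Definition cbox p (r : R) : set (R * R) :=
  [set q | `|q.1 - p.1| <= r /\ `|q.2 - p.2| <= r].

Lemma cbox_compact p r : compact (cbox p r).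
Proof.
have -> : cbox p r = [set` `[p.1 - r, p.1 + r]] `*` [set` `[p.2 - r, p.2 + r]].
  by rewrite predeqE => q; rewrite /cbox /= !in_itv/= !ler_distl.
by apply: compact_setX; exact: segment_compact.
Qed.

Lemma box_open p r : open (box p r).
Proof.
rewrite openE => q [h1 h2].
pose d := Num.min (r - `|q.1 - p.1|) (r - `|q.2 - p.2|).
have d0 : 0 < d by rewrite lt_min !subr_gt0 h1.
apply/nbhs_boxP; exists d => // z [].
rewrite !lt_min => /andP[z1 _] /andP[_ z2]; split.
  rewrite -(subrKA q.1) (le_lt_trans (ler_normD _ _))//; lra.
rewrite -(subrKA q.2) (le_lt_trans (ler_normD _ _))//; lra.
Qed.

(** The image of a small box under an injective map with invertible differential is
    a neighbourhood of the image of the centre: the distance to a nearby value has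
    a minimum in the interior of the box, and the minimum is zero. *)
Lemma open_local D x1 x2 a1 a2 b1 b2 p s r :
  C1_with D x1 a1 b1 -> C1_with D x2 a2 b2 ->
  (forall q, D q -> a1 q * b2 q - b1 q * a2 q != 0) ->
  0 < s -> s < r -> box p r `<=` D ->
  (forall a b, box p r a -> box p r b -> x1 a = x1 b -> x2 a = x2 b -> a = b) ->
  exists2 e : R, 0 < e & forall y : R * R, box (x1 p, x2 p) e y ->
    exists2 c, cbox p s c & (x1 c, x2 c) = y.
Proof.
move=> H1 H2 jac s0 sr rD inj.
have cb : cbox p s `<=` box p r by move=> q [? ?]; split; exact: le_lt_trans sr.
have pp : box p r p by split; rewrite subrr normr0 (lt_trans s0).
pose psi (y q : R * R) := (x1 q - y.1) ^+ 2 + (x2 q - y.2) ^+ 2.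
have psic y q : D q -> {for q, continuous (psi y)}.
  move=> Dq; have [_ _ _ _ c1] := H1 _ Dq; have [_ _ _ _ c2] := H2 _ Dq.
  by apply: continuousD; exact: continuous_sqrB.
have psiK y (K : set (R * R)) : K `<=` D -> {within K, continuous (psi y)}.
  move=> KD; apply: continuous_in_subspaceT => q /set_mem Kq.
  by apply: psic; exact: KD.
pose S := cbox p s `&` ~` box p s.
have cS : compact S.
  apply: compact_closedI; first exact: cbox_compact.
  exact/open_closedC/box_open.
have S0 : S !=set0.
  exists (p + s *: e1); split.
    rewrite /e1; split=> /=; rewrite addrC addKr.
      by rewrite [s *: _]mulr1 ger0_norm// ltW.
    by rewrite [s *: _]mulr0 normr0 ltW.
  case=> /=; rewrite /e1 /= addrC addKr [s *: _]mulr1 ger0_norm ?ltW// ltxx.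
  by [].
have SD : S `<=` D by move=> q [/cb/rD].
have [q0 /set_mem q0S hq0] := compact_EVT_min S0 cS (psiK (x1 p, x2 p) _ SD).
set m := psi _ q0 in hq0.
have m0 : 0 < m.
  rewrite lt_neqAle /m /psi addr_ge0 ?sqr_ge0// andbT eq_sym.
  rewrite paddr_eq0 ?sqr_ge0// !sqrf_eq0 !subr_eq0; apply/negP.
  move=> /andP[/eqP h /eqP h']; case: q0S => q0s; apply.
  have -> : q0 = p by apply: inj => //; exact: cb.
  by split; rewrite subrr normr0.
(* m is the minimum of the squared distance to the value at p over the boundary of
   the box. The choice of e gives 8 e^2 < m, which keeps the minimum of the distance
   to y off that boundary. *)
pose e := Num.min 1 (m / 9).
have e0 : 0 < e by rewrite lt_min ltr01 divr_gt0.
have ee : 8 * e ^+ 2 < m.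
  have e1 : e <= 1 by rewrite ge_min lexx.
  have em : e <= m / 9 by rewrite ge_min lexx orbT.
  have : e ^+ 2 <= e by rewrite expr2 ler_piMl// ltW.
  lra.
exists e => // y [y1 y2].
have ye : psi y p < 2 * e ^+ 2.
  have sq (t : R) : `|t| < e -> t ^+ 2 < e ^+ 2.
    move=> te; rewrite -(real_normK (num_real t)) ltr_pXn2r ?nnegrE//.
    exact: ltW.
  rewrite /psi -[(x1 p - _) ^+ 2]sqrrN -[(x2 p - _) ^+ 2]sqrrN !opprB.
  by have := sq _ y1; have := sq _ y2; rewrite /=; lra.
have K0 : cbox p s !=set0.
  by exists p; split; rewrite subrr normr0 ltW.
have KD : cbox p s `<=` D by move=> q /cb/rD.
have [c /set_mem Kc hc] := compact_EVT_min K0 (@cbox_compact p s) (psiK y _ KD).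
have psip : psi y c <= psi y p.
  by apply: hc; apply/mem_set; split; rewrite subrr normr0 ltW.
have cbx : box p s c.
  apply: contrapT => nc.
  have : m <= psi (x1 p, x2 p) c by apply: hq0; apply/mem_set.
  have : psi (x1 p, x2 p) c <= 2 * psi y c + 2 * psi y p.
    rewrite /psi /=.
    have := sqr_ge0 (x1 c - y.1 + (x1 p - y.1)); have := sqr_ge0 (x2 c - y.2 + (x2 p - y.2)).
    rewrite !expr2; nra.
  lra.
exists c => //.
have Dc := KD _ Kc.
have /nbhs_boxP[d d0 hd] : nbhs c (box p s).
  by apply: open_nbhs_nbhs; split=> //; exact: box_open.
have crit (e' : R * R) (g1 g2 : R * R -> R) :
    (forall q, D q -> is_derive q e' x1 (g1 q)) ->
    (forall q, D q -> is_derive q e' x2 (g2 q)) ->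
    (x1 c - y.1) * g1 c + (x2 c - y.2) * g2 c = 0.
  move=> G1 G2; have [d' d'0 hd'] := box_line c e' d0.
  pose h t := psi y (c + t *: e').
  pose dh t := 2 * ((x1 (c + t *: e') - y.1) * g1 (c + t *: e') +
    (x2 (c + t *: e') - y.2) * g2 (c + t *: e')).
  have : dh 0 = 0.
    apply: (@local_min_derive h dh d') => // t td.
      have Dt : D (c + t *: e').
        apply: KD; have [? ?] := hd _ (hd' _ td); split; exact: ltW.
      have i1 := is_derive_line (G1 _ Dt); have i2 := is_derive_line (G2 _ Dt).
      exact: is_derive_sumsq i1 i2.
    rewrite /h scale0r addr0; apply: hc; apply/mem_set.
    by have [? ?] := hd _ (hd' _ td); split; exact: ltW.
  by rewrite /dh scale0r addr0 => /eqP; rewrite mulf_eq0 pnatr_eq0/= => /eqP.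
have C1 := crit e1 a1 a2 (fun q Dq => let: And5 h _ _ _ _ := H1 q Dq in h)
   (fun q Dq => let: And5 h _ _ _ _ := H2 q Dq in h).
have C2 := crit e2 b1 b2 (fun q Dq => let: And5 _ h _ _ _ := H1 q Dq in h)
   (fun q Dq => let: And5 _ h _ _ _ := H2 q Dq in h).
have J := jac _ Dc.
have X1 : x1 c - y.1 = 0.
  apply: (mulIf J); rewrite mul0r.
  transitivity (b2 c * ((x1 c - y.1) * a1 c + (x2 c - y.2) * a2 c) -
    a2 c * ((x1 c - y.1) * b1 c + (x2 c - y.2) * b2 c)); first by ring.
  by rewrite C1 C2; ring.
have X2 : x2 c - y.2 = 0.
  apply: (mulIf J); rewrite mul0r.
  transitivity (a1 c * ((x1 c - y.1) * b1 c + (x2 c - y.2) * b2 c) -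
    b1 c * ((x1 c - y.1) * a1 c + (x2 c - y.2) * a2 c)); first by ring.
  by rewrite C1 C2; ring.
by move/subr0_eq: X1 => ->; move/subr0_eq: X2 => ->; case: (y).
Qed.
End PlaneCalculus.

(** * Charts *)

Section ComplexPlane.
Context {R : realType}.

Lemma cplxK (p : R * R) : uncplx (cplx p) = p.
Proof. by case: p. Qed.

Lemma uncplxK (z : R[i]) : cplx (uncplx z) = z.
Proof. by case: z. Qed.

Lemma cplx_continuous : continuous (@cplx R).
Proof.
move=> p A /nbhs_ballP[e /= e0 eA]; apply/nbhs_boxP.
move: e0; rewrite ltcE /= => /andP[/eqP Ime Ree].
have eE : e = (complex.Re e)%:C%C by move: Ime; case: (e) => a b /= ->.
exists (complex.Re e / 2); first by rewrite divr_gt0.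
move=> q [q1 q2]; apply: eA; rewrite -ball_normE /ball_ /= eE normc_def ltcR.
set a := complex.Re _; set b := complex.Im _.
have ha : `|a| < complex.Re e / 2 by move: q1; rewrite distrC.
have hb : `|b| < complex.Re e / 2 by move: q2; rewrite distrC.
clearbody a b; apply: (@le_lt_trans _ _ (`|a| + `|b|)); last by lra.
rewrite -[leRHS]ger0_norm ?addr_ge0// -(sqrtr_sqr (`|a| + `|b|)) ler_sqrt ?sqr_ge0//.
rewrite sqrrD !real_normK ?num_real// -addrA lerD2l lerDr.
by rewrite mulrn_wge0// mulr_ge0.
Qed.

Lemma uncplx_continuous : continuous (@uncplx R).
Proof.
move=> z A /nbhs_boxP[r r0 rA]; apply/nbhs_ballP; exists r%:C%C; first by rewrite /= ltcR.
move=> w; rewrite -ball_normE /ball_ /= normc_def ltcR => zw; apply: rA.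
have bound (a b : R) : Num.sqrt (a ^+ 2 + b ^+ 2) < r -> `|a| < r /\ `|b| < r.
  move=> ab; split; rewrite -sqrtr_sqr (le_lt_trans _ ab)// ler_sqrt ?addr_ge0 ?sqr_ge0//.
    by rewrite lerDl sqr_ge0.
  by rewrite lerDr sqr_ge0.
have [] := bound _ _ zw; case: z w {zw} => [a b] [c d] /=.
by rewrite /box /= distrC => ha hb; split=> //=; rewrite distrC.
Qed.
End ComplexPlane.

Section Charts.
Context {R : realType} {T : topologicalType}.
Implicit Types (c : chart R T) (q : T).

(** The parametrisation inverse to the coordinates of c. *)
Definition param c (p : R * R) : T := chart_inv c (cplx p).

Lemma coordK c q : chart_dom c q -> param c (coord c q) = q.
Proof. by move=> cq; rewrite /param /coord uncplxK chart_mapK. Qed.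

Lemma coord_continuous c q : chart_dom c q -> {for q, continuous (coord c)}.
Proof.
move=> cq; apply: continuous_comp; last exact: uncplx_continuous.
have := @chart_map_cont _ _ c; rewrite continuous_open_subspace; last first.
  exact: chart_dom_open.
by apply; exact/mem_set.
Qed.

(** The inverse of a chart maps points near the coordinates of q to points near
    q. *)
Lemma param_near c q (W : set T) : chart_dom c q -> nbhs q W ->
  \forall p \near coord c q,
    [/\ chart_dom c (param c p), coord c (param c p) = p & W (param c p)].
Proof.
move=> cq qW.
have imq : (chart_map c @` chart_dom c) (chart_map c q) by exists q.
have iq : nbhs (chart_map c q) (chart_map c @` chart_dom c).
  by apply: open_nbhs_nbhs; split=> //; exact: chart_img_open.
have ic : {for chart_map c q, continuous (chart_inv c)}.
  have := @chart_inv_cont _ _ c; rewrite continuous_open_subspace; last first.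
    exact: chart_img_open.
  by apply; exact/mem_set.
have := ic W; rewrite chart_mapK// => /(_ qW) iW.
pose Q z := [/\ chart_dom c (chart_inv c z),
  chart_map c (chart_inv c z) = z & W (chart_inv c z)].
have H : nbhs (cplx (coord c q)) Q.
  rewrite /coord uncplxK; apply: filterS2 iq iW => z [q' cq' <-].
  by rewrite /Q /= !chart_mapK.
have H' : \forall p \near coord c q, Q (cplx p) by exact: cplx_continuous H.
apply: filterS H' => p [d e w].
by split=> //; rewrite /coord e cplxK.
Qed.

Lemma coord_image_open c (S : set T) : open S -> open (coord_image c S).
Proof.
move=> oS; rewrite openE => _ [q [cq Sq] <-].
have qS : nbhs q S by exact: open_nbhs_nbhs.
have := param_near cq qS; apply: filterS => p [d e w].
by exists (param c p).
Qed.

Lemma coord_image_param c (S : set T) p : coord_image c S p ->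
  [/\ chart_dom c (param c p), coord c (param c p) = p & S (param c p)].
Proof. by move=> [q [cq Sq] <-]; rewrite coordK. Qed.

Lemma param_continuous c p : coord_image c setT p -> {for p, continuous (param c)}.
Proof.
move=> /coord_image_param[cp pe _] W Wp.
by have := param_near cp Wp; rewrite pe; apply: filterS => p' [].
Qed.
End Charts.

(** * The immersion near an interior point *)

Section LocalImmersion.
Context {R : realType} {T : topologicalType}.
Variables (A : set (chart R T)) (M : set T) (L : set (set T)) (X : T -> 'rV[R]_3).
Hypotheses (cover : \bigcup_(c in A) chart_dom c = setT)
  (hM : bordered_surface A M L) (hX : conformal_maximal_immersion A M X).
Implicit Types (c : chart R T) (j : 'I_3) (p : R * R).

(** Two points are identified when they lie on a common boundary curve. *)
Definition same_class (a b : T) : Prop :=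
  a = b \/ exists2 gamma, L gamma & gamma a /\ gamma b.

(** The projection of X to the spacelike coordinate plane. *)
Definition shadow (q : T) : R * R := (X q 0 i1, X q 0 i2).

(** The timelike coordinate of X. *)
Definition height (q : T) : R := X q 0 i3.

(** The Euclidean norm; the norm carried by the product type is the maximum
    norm. *)
Definition enorm p : R := Num.sqrt (p.1 ^+ 2 + p.2 ^+ 2).

Lemma enormZ (s : R) p : enorm (s *: p) = `|s| * enorm p.
Proof.
rewrite /enorm /= [s *: p.1]/(s * p.1) [s *: p.2]/(s * p.2) !exprMn -mulrDr.
by rewrite sqrtrM ?sqr_ge0// sqrtr_sqr.
Qed.

Lemma le_enorm (x : R) p : (`|x| <= enorm p) = (x ^+ 2 <= p.1 ^+ 2 + p.2 ^+ 2).
Proof. by rewrite -sqrtr_sqr ler_sqrt// addr_ge0 ?sqr_ge0. Qed.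


Lemma lt_enorm (x : R) p : (`|x| < enorm p) = (x ^+ 2 < p.1 ^+ 2 + p.2 ^+ 2).
Proof.
rewrite -sqrtr_sqr /enorm; have [h|h] := ltP 0 (p.1 ^+ 2 + p.2 ^+ 2).
  by rewrite ltr_sqrt.
have -> : p.1 ^+ 2 + p.2 ^+ 2 = 0 by apply/le_anti; rewrite h addr_ge0 ?sqr_ge0.
by rewrite sqrtr0 !ltNge sqrtr_ge0 sqr_ge0.
Qed.

(** The coordinate function j of X in the chart c, its partial derivatives, and the
    derivatives of those: entry12 differentiates first along e1, then along e2. *)
Definition entry c j p : R := local_expr c X p 0 j.
Definition entry1 c j p : R := ('D_e1 (local_expr c X) p) 0 j.
Definition entry2 c j p : R := ('D_e2 (local_expr c X) p) 0 j.
Definition entry11 c j p : R := ('D_e1 ('D_e1 (local_expr c X)) p) 0 j.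
Definition entry12 c j p : R := ('D_e2 ('D_e1 (local_expr c X)) p) 0 j.
Definition entry21 c j p : R := ('D_e1 ('D_e2 (local_expr c X)) p) 0 j.
Definition entry22 c j p : R := ('D_e2 ('D_e2 (local_expr c X)) p) 0 j.

Lemma Ck_entry (D : set (R * R)) (x : R * R -> 'rV[R]_3) j : Ck 2 D x ->
  C1_with D (fun p => x p 0 j) (fun p => ('D_e1 x p) 0 j) (fun p => ('D_e2 x p) 0 j).
Proof.
move=> [dx [[d1 _] [d2 _]]] p Dp.
have ent (y : R * R -> 'rV[R]_3) : differentiable y p ->
    {for p, continuous (fun p => y p 0 j)}.
  move=> /differentiable_continuous yc.
  apply: (continuous_comp yc (g := fun N : 'rV[R]_3 => N 0 j)).
  exact/differentiable_continuous/differentiable_coord.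
split; [| |exact/ent/d1|exact/ent/d2|exact/ent/dx].
- by apply: is_derive_entry; apply: diff_derivable; exact: dx.
- by apply: is_derive_entry; apply: diff_derivable; exact: dx.
Qed.

Lemma entry_C1 c j : A c ->
  C1_with (coord_image c setT) (entry c j) (entry1 c j) (entry2 c j).
Proof. by move=> Ac; exact: (Ck_entry j (cmi_smooth hX Ac 2)). Qed.

Lemma entry1_C1 c j : A c ->
  C1_with (coord_image c setT) (entry1 c j) (entry11 c j) (entry12 c j).
Proof.
by move=> Ac; have [_ [H _]] := cmi_smooth hX Ac 3; exact: (Ck_entry j H).
Qed.

Lemma entry2_C1 c j : A c ->
  C1_with (coord_image c setT) (entry2 c j) (entry21 c j) (entry22 c j).
Proof.
by move=> Ac; have [_ [_ H]] := cmi_smooth hX Ac 3; exact: (Ck_entry j H).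
Qed.

Lemma entry_coord c j q : chart_dom c q -> entry c j (coord c q) = X q 0 j.
Proof. by move=> cq; rewrite /entry /local_expr -/(param c _) coordK. Qed.

Lemma conformal_at c p : A c -> coord_image c setT p -> exists2 l : R, 0 <= l &
  [/\ entry1 c i1 p ^+ 2 + entry1 c i2 p ^+ 2 - entry1 c i3 p ^+ 2 = l,
      entry2 c i1 p ^+ 2 + entry2 c i2 p ^+ 2 - entry2 c i3 p ^+ 2 = l &
      entry1 c i1 p * entry2 c i1 p + entry1 c i2 p * entry2 c i2 p -
        entry1 c i3 p * entry2 c i3 p = 0].
Proof.
move=> Ac [q [cq _] <-]; have [l l0 h] := cmi_conformal hX Ac cq.
exists l => //; split.
- by have := h e1 e1; rewrite /first_form /lorentz /e1 /= !mulr1 mulr0 addr0 mulr1 !expr2.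
- by have := h e2 e2; rewrite /first_form /lorentz /e2 /= !mulr1 mulr0 add0r mulr1 !expr2.
- by have := h e1 e2; rewrite /first_form /lorentz /e1 /e2 /= !mulr0 mul0r addr0 mulr0.
Qed.

Lemma interior_conformal_at c p : A c -> coord_image c (interior M) p ->
  exists2 l : R, 0 < l &
  [/\ entry1 c i1 p ^+ 2 + entry1 c i2 p ^+ 2 - entry1 c i3 p ^+ 2 = l,
      entry2 c i1 p ^+ 2 + entry2 c i2 p ^+ 2 - entry2 c i3 p ^+ 2 = l &
      entry1 c i1 p * entry2 c i1 p + entry1 c i2 p * entry2 c i2 p -
        entry1 c i3 p * entry2 c i3 p = 0].
Proof.
move=> Ac [q [cq Mq] pq].
have [|l l0 H] := @conformal_at c p Ac; first by exists q.
exists l => //; case: H => <- _ _.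
have /(_ e1) := cmi_spacelike hX Mq Ac cq.
rewrite /first_form /lorentz -pq -!expr2; apply.
by apply/eqP => -[/eqP]; rewrite oner_eq0.
Qed.

Lemma ord3_cases j : j = i1 \/ j = i2 \/ j = i3.
Proof.
case: j => -[|[|[|//]]] h; [left|right; left|right; right];
  by apply/val_inj; rewrite /= inordK.
Qed.

Lemma X_entry_continuous j : continuous (fun q => X q 0 j).
Proof.
move=> q; have [c Ac cq] : (\bigcup_(c in A) chart_dom c) q by rewrite cover.
have cont : {for coord c q, continuous (entry c j)}.
  by have [|_ _ _ _] := entry_C1 j Ac (p := coord c q); first by exists q.
have h : entry c j (coord c q') @[q' --> q] --> entry c j (coord c q).
  exact: continuous_comp (coord_continuous cq) cont.
rewrite entry_coord// in h.
apply: cvg_trans h; apply: near_eq_cvg.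
have : nbhs q (chart_dom c) by apply: open_nbhs_nbhs; split=> //; exact: chart_dom_open.
by apply: filterS => q' cq' /=; rewrite entry_coord.
Qed.

Lemma shadow_continuous : continuous shadow.
Proof.
by move=> q; exact: (cvg_pair (@X_entry_continuous i1 q) (@X_entry_continuous i2 q)).
Qed.

Lemma height_continuous : continuous height.
Proof. exact: X_entry_continuous. Qed.

(** With P, Q the partial derivatives and l > 0 the conformal factor, the square of
    this determinant is l^2 + l (P3^2 + Q3^2). *)
Lemma jacobian_neq0 c p : A c -> coord_image c (interior M) p ->
  entry1 c i1 p * entry2 c i2 p - entry2 c i1 p * entry1 c i2 p != 0.
Proof.
move=> Ac Mp; have [l l0 [hP hQ hPQ]] := interior_conformal_at Ac Mp.
move: (entry1 c i1 p) (entry1 c i2 p) (entry1 c i3 p) (entry2 c i1 p) (entry2 c i2 p)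
  (entry2 c i3 p) hP hQ hPQ => P1 P2 P3 Q1 Q2 Q3 hP hQ hPQ.
apply/eqP => J0.
have : (P1 * Q2 - Q1 * P2) ^+ 2 = l ^+ 2 + l * (P3 ^+ 2 + Q3 ^+ 2).
  transitivity ((P1 ^+ 2 + P2 ^+ 2) * (Q1 ^+ 2 + Q2 ^+ 2) - (P1 * Q1 + P2 * Q2) ^+ 2).
    by ring.
  have -> : P1 ^+ 2 + P2 ^+ 2 = l + P3 ^+ 2 by rewrite -hP; ring.
  have -> : Q1 ^+ 2 + Q2 ^+ 2 = l + Q3 ^+ 2 by rewrite -hQ; ring.
  have -> : P1 * Q1 + P2 * Q2 = P3 * Q3 by apply/eqP; rewrite -subr_eq0 hPQ.
  by ring.
rewrite J0 expr0n /= => /esym/eqP; apply/negP; rewrite gt_eqF//.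
by rewrite ltr_wpDr ?exprn_gt0// mulr_ge0 ?addr_ge0 ?sqr_ge0// ltW.
Qed.

Lemma same_class_interior a b : interior M a -> same_class a b -> a = b.
Proof.
move=> Ma [//|[gamma Lg [ga _]]].
have : (frontier M) a by rewrite (bs_frontier hM); exists gamma.
by case.
Qed.

Lemma interior_nice a : interior M a ->
  exists C U e, nice M same_class shadow height enorm a C U e /\ C `<=` interior M.
Proof.
move=> Ma; have [c Ac ca] : (\bigcup_(c in A) chart_dom c) a by rewrite cover.
pose p := coord c a; pose D := coord_image c (interior M).
have oD : open D by apply: coord_image_open; exact: open_interior.
have Dp : D p by exists a.
have DT : D `<=` coord_image c setT by move=> _ [q [cq _] <-]; exists q.
have C1 j : C1_with D (entry c j) (entry1 c j) (entry2 c j).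
  by move=> q Dq; apply: entry_C1 => //; exact: DT.
have [l l0 [hP hQ hPQ]] := interior_conformal_at Ac Dp.
have [r [r0 rD sp]] := spacelike_local oD Dp (C1 i1) (C1 i2) (C1 i3) l0 hP hQ hPQ.
have inj x y : box p r x -> box p r y -> entry c i1 x = entry c i1 y ->
    entry c i2 x = entry c i2 y -> x = y.
  move=> px py h1 h2; apply/eqP/negPn/negP => /(sp _ _ px py).
  by rewrite h1 h2 !subrr expr0n addr0 ltNge sqr_ge0.
have s0 : 0 < r / 2 by rewrite divr_gt0.
have sr : r / 2 < r by lra.
have [e e0 he] := open_local (C1 i1) (C1 i2) (fun q Dq => jacobian_neq0 Ac Dq)
  s0 sr rD inj.
set s := r / 2 in s0 sr he.
have cb : cbox p s `<=` box p r by move=> q [? ?]; split; exact: le_lt_trans sr.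
pose C := param c @` cbox p s.
pose U := [set q | chart_dom c q /\ box p s (coord c q)].
have par x : box p r x -> [/\ chart_dom c (param c x), coord c (param c x) = x &
    interior M (param c x)].
  by move=> /rD/coord_image_param.
have shE q : chart_dom c q ->
    shadow q = (entry c i1 (coord c q), entry c i2 (coord c q)).
  by move=> cq; rewrite !entry_coord.
have CM : C `<=` interior M by move=> _ [x /cb/par[_ _ ?] <-].
have UM : U `<=` interior M.
  move=> q [cq bq]; rewrite -(coordK cq).
  by have [] := par _ (sub_box (ltW sr) bq).
have UC : U `<=` C.
  move=> q [cq [b1 b2]]; exists (coord c q); last exact: coordK.
  by split; exact: ltW.
have bpp t : 0 < t -> box p t p by move=> t0; split; rewrite subrr normr0.
have Cbox b : C b -> [/\ chart_dom c b, box p r (coord c b) & b = param c (coord c b)].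
  by move=> [x /cb xr <-]; have [dx ex _] := par _ xr; rewrite ex.
exists C, U, e; split=> //; split=> //.
- apply: continuous_compact; last exact: cbox_compact.
  apply: continuous_in_subspaceT => x /set_mem/cb/rD/DT; exact: param_continuous.
- by move=> b /CM/interior_subset.
- by move=> b b' Cb _ /(same_class_interior (CM _ Cb)) <-.
- move=> b b' /Cbox[cb1 rb1 eb] /Cbox[cb2 rb2 eb']; rewrite !shE// => -[h1 h2].
  by left; rewrite eb eb'; congr (param _ _); exact: inj.
- rewrite openE => q [cq bq].
  have n1 : nbhs q (chart_dom c).
    by apply: open_nbhs_nbhs; split=> //; exact: chart_dom_open.
  have bo : nbhs (coord c q) (box p s).
    by apply: open_nbhs_nbhs; split=> //; exact: box_open.
  have n2 := coord_continuous cq bo.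
  by apply: filterS2 n1 n2.
- move=> b _ /(same_class_interior Ma) <-; split=> //; exact: bpp.
- by move=> b [/UC].
- by move=> b b' [Ub Mb] Mb' /(same_class_interior (UM _ Ub)) <-.
- move=> y yF; have [|x xs <-] := he y.
    move: yF; rewrite prod_normE gt_max => /andP[y1 y2].
    by rewrite /p !entry_coord.
  exists (param c x); first by exists x.
  have [dx ex _] := par _ (cb _ xs).
  by rewrite shE// ex.
- move=> b Cb; have [cb1 rb1 _] := Cbox _ Cb.
  rewrite le_enorm; have [ab|ab] := eqVneq p (coord c b).
    have -> : b = a by rewrite -(coordK cb1) -ab coordK.
    by rewrite !subrr expr0n/= addr0.
  have := sp _ _ (bpp _ r0) rb1 ab.
  by rewrite !entry_coord// => /ltW.
- move=> b Cb nE; have [cb1 rb1 _] := Cbox _ Cb.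
  rewrite lt_enorm; have := sp _ _ (bpp _ r0) rb1 _.
  rewrite !entry_coord//; apply; apply: contra_notN nE => /eqP pb.
  by left; rewrite -(coordK ca) -(coordK cb1) -/p pb.
Qed.
End LocalImmersion.

(** * The immersion near a conelike singularity *)

Section ConelikePoints.
Context {R : realType} {T : topologicalType}.
Variables (A : set (chart R T)) (M : set T) (L : set (set T)) (X : T -> 'rV[R]_3).
Hypotheses (cover : \bigcup_(c in A) chart_dom c = setT)
  (hM : bordered_surface A M L) (hX : conformal_maximal_immersion A M X).
Local Notation same_class := (same_class L).
Local Notation shadow := (shadow X).
Local Notation height := (height X).

Hypotheses (hT : hausdorff_space T) (hproper : proper_on M X).

Lemma compact_closed_nbhd (K W : set T) : compact K ->
  (forall x, K x -> exists N, [/\ nbhs x N, closed N & N `<=` W]) ->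
  exists N, [/\ closed N, K `<=` interior N & N `<=` W].
Proof.
move=> cK HK.
have [-> |/set0P[x0 _]] := eqVneq K set0.
  by exists set0; split=> //; exact: closed0.
pose Tp : ptopologicalType := HB.pack T (isPointed.Build T x0).
have : forall x, exists N, K x -> [/\ nbhs x N, closed N & N `<=` W].
  move=> x; have [Kx|nKx] := pselect (K x); last by exists set0.
  by have [N HN] := HK x Kx; exists N.
move=> /choice[N HN].
have : @cover_compact Tp K by rewrite -(compact_cover Tp).
move=> /(_ T K (fun x => interior (N x))) [||D DK KD].
- by move=> x _; exact: open_interior.
- by move=> x Kx; exists x => //; have [] := HN x Kx.
exists (\bigcup_(x in [set` D]) N x); split.
- apply: closed_bigcup => [|x /= xD]; first exact: finite_fset.
  by have /set_mem/HN[] := DK _ xD.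
- move=> x /KD[y yD Nx]; apply: filterS Nx => z Nz; by exists y.
- by move=> z [x /= xD]; have /set_mem/HN[_ _] := DK _ xD; apply.
Qed.

Lemma compact_nbhd (x : T) : exists2 V, compact V & nbhs x V.
Proof.
have [c Ac cx] : (\bigcup_(c in A) chart_dom c) x by rewrite cover.
have : nbhs (coord c x) (coord_image c setT).
  by apply: open_nbhs_nbhs; split; [exact/coord_image_open/openT|exists x].
move=> /nbhs_boxP[r r0 rD].
have s0 : 0 < r / 2 by rewrite divr_gt0.
have cb : cbox (coord c x) (r / 2) `<=` box (coord c x) r.
  by move=> q [? ?]; split; lra.
exists (param c @` cbox (coord c x) (r / 2)).
  apply: continuous_compact; last exact: cbox_compact.
  apply: continuous_in_subspaceT => y /set_mem/cb/rD; exact: param_continuous.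
have n1 : nbhs x (chart_dom c).
  by apply: open_nbhs_nbhs; split=> //; exact: chart_dom_open.
have n2 := coord_continuous cx (nbhs_box (coord c x) s0).
apply: filterS2 n1 n2 => q cq [b1 b2]; exists (coord c q); last exact: coordK.
by split; exact: ltW.
Qed.

Lemma proper_box (B : R) :
  compact (M `&` [set q | `|shadow q| <= B /\ `|height q| <= B]).
Proof.
pose K : set 'rV[R]_3 := [set x | forall j, `|x 0 j| <= B].
have -> : [set q | `|shadow q| <= B /\ `|height q| <= B] = X @^-1` K.
  rewrite predeqE => q /=; rewrite prod_normE ge_max; split.
    by move=> [/andP[? ?] ?] j; have [->|[->|->]] := ord3_cases j.
  by move=> h; split; [apply/andP; split|]; exact: h.
apply: hproper; apply: bounded_closed_compact.
  have [|B0] := leP 0 B; last first.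
    exists 0; split=> // x x0 y /(_ i1) h.
    by have := le_lt_trans h B0; rewrite ltNge normr_ge0.
  exists B; split; first exact: num_real.
  move=> y By x hx; rewrite /= (_ : `|x| = mx_norm x)// mx_normrE.
  apply: (le_trans _ (ltW By)); apply: bigmax_le => [|[k l] _] //=.
  by rewrite ord1; exact: hx.
have -> : K = \bigcap_(j in [set: 'I_3]) ((fun x : 'rV[R]_3 => x 0 j) @^-1` [set t | `|t| <= B]).
  by rewrite predeqE => x; split=> [h j _|h j]; exact: h.
apply: closed_bigI => j _; apply: preimage_closed.
  by move=> x _; exact/differentiable_continuous/differentiable_coord.
have -> : [set t : R | `|t| <= B] = (@Num.norm R R) @^-1` [set t | t <= B] by [].
by apply: preimage_closed; [move=> t _; exact: norm_continuous|exact: closed_le].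
Qed.

Lemma loop_compact gamma : L gamma -> compact gamma.
Proof.
move=> Lg; have [l [lc _ _ -> _]] := bs_loops hM Lg.
by apply: continuous_compact => //; exact: segment_compact.
Qed.

Lemma loop_sub_frontier gamma : L gamma -> gamma `<=` frontier M.
Proof. by move=> Lg q gq; rewrite (bs_frontier hM); exists gamma. Qed.

Lemma frontier_sub : frontier M `<=` M.
Proof.
by move=> q [+ _]; have /closure_id <- := bs_closed hM.
Qed.

Lemma loop_eq g1 g2 q : L g1 -> L g2 -> g1 q -> g2 q -> g1 = g2.
Proof.
by move=> L1 L2 q1 q2; apply: (bs_disjoint hM L1 L2); exists q.
Qed.

(** By local finiteness a loop has a neighbourhood that meets no other loop. *)
Lemma loop_isolated gamma : L gamma -> exists W, [/\ open W, gamma `<=` W &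
  forall g, L g -> g `&` W !=set0 -> g = gamma].
Proof.
move=> Lg; pose B := \bigcup_(g in [set g | L g /\ g <> gamma]) g.
exists (interior (~` B)); split; first exact: open_interior.
- move=> q gq; have [V qV finV] := bs_locally_finite hM q.
  pose G := [set g | (L g /\ g `&` V !=set0) /\ g <> gamma].
  have fG : finite_set G by apply: sub_finite_set finV => g [].
  have cG : closed (\bigcup_(g in G) g).
    apply: closed_bigcup => // g [[L' _] _].
    by apply: compact_closed => //; exact: loop_compact.
  have qG : nbhs q (~` \bigcup_(g in G) g).
    apply: open_nbhs_nbhs; split; first exact: closed_openC.
    by move=> [g [[L' _] ng] g'q]; apply: ng; exact: (loop_eq L' Lg g'q gq).
  apply: filterS2 qV qG => z Vz nz [g [L' ng] gz]; apply: nz.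
  by exists g => //; split=> //; split=> //; exists z.
- move=> g L' [q [gq /interior_subset nB]]; apply: contrapT => ng.
  by apply: nB; exists g.
Qed.

Lemma same_class_refl a : same_class a a.
Proof. by left. Qed.

Lemma same_class_sym a b : same_class a b -> same_class b a.
Proof. by move=> [->|[g Lg [ga gb]]]; [left|right; exists g]. Qed.

Lemma same_class_trans a b c : same_class a b -> same_class b c -> same_class a c.
Proof.
move=> [->//|[g Lg [ga gb]]] [<-|[g' Lg' [gb' gc]]]; right; first by exists g.
by exists g => //; split=> //; rewrite (loop_eq Lg Lg' gb gb').
Qed.

Hypothesis hcone : forall gamma, L gamma -> conelike_singularity A M X gamma.

Lemma loop_constant gamma a b : L gamma -> gamma a -> gamma b -> X a = X b.
Proof.
move=> Lg ga gb; have [_ [x Xg] _] := hcone Lg.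
have : (X @` gamma) (X a) by exists a.
have : (X @` gamma) (X b) by exists b.
by rewrite Xg /= => -> ->.
Qed.

Lemma same_classX a b : same_class a b -> X a = X b.
Proof. by move=> [->//|[g Lg [ga gb]]]; exact: loop_constant ga gb. Qed.

(** The embedding property of a conelike singularity, expressed on M instead of on
    the space with gamma collapsed. *)
Lemma conelike_injective gamma : L gamma -> exists W, [/\ open W, gamma `<=` W &
  forall b c, W b -> W c -> M b -> M c -> shadow b = shadow c ->
    b = c \/ gamma b /\ gamma c].
Proof.
move=> Lg; have [_ _ [U [oU gU [_ [h [_ hK]]]]]] := hcone Lg.
have [W oW WE] : exists2 W : set T, open W &
    @set_val T M @^-1` W = @collapse T M gamma @^-1` U.
  exact: oU.
pose pt b (Mb : M b) : M := exist _ b (mem_set Mb).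
have valpt b (Mb : M b) : \val (pt b Mb) = b by [].
have WU b (Mb : M b) : W b -> U (collapse gamma (pt b Mb)).
  by move=> Wb; have : (@set_val T M @^-1` W) (pt b Mb) by []; rewrite WE.
exists W; split=> //.
  move=> q gq; have Mq : M q by apply/frontier_sub/(loop_sub_frontier Lg).
  have : (@collapse T M gamma @^-1` U) (pt q Mq) by exact: gU.
  by rewrite -WE.
have ind b (Mb : M b) :
    induced_map (gamma := gamma) X (collapse gamma (pt b Mb)) = X b.
  rewrite /induced_map /collapse.
  have /eqmodP : (repr (\pi_{eq_quot (collapse_equiv M gamma)} (pt b Mb))
      = pt b Mb %[mod {eq_quot (collapse_equiv M gamma)}])%qT by rewrite reprK.
  move=> /orP[/eqP->//|/asboolP[g1 g2]].
  exact: loop_constant g1 g2.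
move=> b c Wb Wc Mb Mc bc.
have pe : pi0 (X b) = pi0 (X c).
  apply/rowP => j; rewrite !mxE; case: eqP => // /eqP j3.
  move: bc => [e1 e2]; case: j j3 => -[|[|[|//]]] hj j3.
  - by have -> : Ordinal hj = i1 by apply/val_inj; rewrite /= inordK.
  - by have -> : Ordinal hj = i2 by apply/val_inj; rewrite /= inordK.
  - by move: j3; rewrite -val_eqE /= inordK.
have : collapse gamma (pt b Mb) = collapse gamma (pt c Mc).
  rewrite -(hK _ (WU b Mb Wb)) -(hK _ (WU c Mc Wc)) /= !ind.
  by rewrite pe.
move=> /eqmodP/orP[/eqP/(congr1 val)|/asboolP]; first by left.
by right.
Qed.

Lemma shadowE a b : X a = X b -> shadow a = shadow b.
Proof. by move=> E; congr pair; rewrite E. Qed.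

Lemma heightE a b : X a = X b -> height a = height b.
Proof. by exact: (congr1 (fun x : 'rV[R]_3 => x 0 i3)). Qed.

(** A compact neighbourhood of a conelike loop that meets no other loop and on which
    the projection is injective up to the loop. *)
Lemma conelike_nbhd gamma a : L gamma -> gamma a -> exists C U,
  [/\ compact C /\ C `<=` M, open U /\ gamma `<=` U, U `&` M `<=` C,
   forall b c, C b -> C c -> shadow b = shadow c -> b = c \/ gamma b /\ gamma c &
   forall g q, L g -> g q -> C q -> g = gamma].
Proof.
move=> Lg ga.
have [W1 [oW1 gW1 isol]] := loop_isolated Lg.
have [W2 [oW2 gW2 inj]] := conelike_injective Lg.
have [|N [cN gN NW]] := @compact_closed_nbhd gamma (W1 `&` W2) (loop_compact Lg).
  move=> x gx; have [V cV xV] := compact_nbhd x.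
  have xW : nbhs x (W1 `&` W2).
    apply: open_nbhs_nbhs; split; first exact: openI.
    by split; [exact: gW1|exact: gW2].
  have [B xB BW] := @compact_regular T x V hT cV xV _ xW.
  exists (closure B); split=> //; last exact: closed_closure.
  by apply: filterS xB; exact: subset_closure.
pose B := `|shadow a| + `|height a| + 1.
have shc := shadow_continuous cover hX.
have hec := height_continuous cover hX.
have oS : open (shadow @^-1` [set p | `|p| < B]).
  apply: open_comp; first by move=> q _; exact: shc.
  have -> : [set p : R * R | `|p| < B] = (@Num.norm R _) @^-1` [set t | t < B] by [].
  by apply: open_comp; [move=> q _; exact: norm_continuous|exact: open_lt].
have oH : open (height @^-1` [set t | `|t| < B]).
  apply: open_comp; first by move=> q _; exact: hec.
  have -> : [set t : R | `|t| < B] = (@Num.norm R R) @^-1` [set t | t < B] by [].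
  by apply: open_comp; [move=> q _; exact: norm_continuous|exact: open_lt].
exists ((M `&` [set q | `|shadow q| <= B /\ `|height q| <= B]) `&` N).
exists (interior N `&` (shadow @^-1` [set p | `|p| < B] `&` height @^-1` [set t | `|t| < B])).
have CW q : ((M `&` [set q | `|shadow q| <= B /\ `|height q| <= B]) `&` N) q ->
    [/\ M q, W1 q & W2 q] by move=> [[Mq _] /NW[]].
split.
- by split; [apply: compact_closedI => //; exact: proper_box|move=> q [[]]].
- split; first by apply: openI; [exact: open_interior|exact: openI].
  move=> q gq; split; first exact: gN.
  have E := loop_constant Lg gq ga.

  rewrite /= (shadowE E) (heightE E) /B.
  by split; have := normr_ge0 (shadow a); have := normr_ge0 (height a); lra.
- move=> q [[/interior_subset Nq [sq hq]] Mq]; split=> //; split=> //.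
  by split; exact: ltW.
- by move=> b c /CW[Mb _ Wb] /CW[Mc _ Wc]; exact: inj.
- by move=> g q L' gq /CW[_ Wq _]; apply: isol => //; exists q.
Qed.

(** In this section C is such a compact neighbourhood of gamma, U an open set
    between gamma and C, p the projection of the loop, and e a radius such that the
    points of C over the disc of radius e around p lie in U. *)
Section Onto.
Variables (gamma : set T) (a : T) (C U : set T) (e : R).
Hypotheses (Lg : L gamma) (ga : gamma a) (cC : compact C) (CM : C `<=` M)
  (oU : open U) (gU : gamma `<=` U) (UC : U `&` M `<=` C)
  (inj : forall b c, C b -> C c -> shadow b = shadow c -> b = c \/ gamma b /\ gamma c)
  (isol : forall g q, L g -> g q -> C q -> g = gamma)
  (e0 : 0 < e) (hU : forall c, C c -> `|shadow c - shadow a| < e -> U c).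

Let p := shadow a.

Lemma loop_in q : gamma q -> C q /\ M q.
Proof.
move=> gq; have Mq : M q by exact/frontier_sub/(loop_sub_frontier Lg).
by split=> //; apply: UC; split=> //; exact: gU.
Qed.

Lemma off_loop_interior q : C q -> ~ gamma q -> interior M q.
Proof.
move=> Cq ng; apply: contrapT => nM.
have : frontier M q.
  by split=> //; have /closure_id <- := bs_closed hM; exact: CM.
rewrite (bs_frontier hM) => -[g L' gq]; apply: ng.
by rewrite -(isol L' gq Cq).
Qed.

Lemma shadow_loop q : gamma q -> shadow q = p.
Proof.
by move=> gq; apply: shadowE; exact: loop_constant gq ga.
Qed.

Lemma shadow_loopP q : C q -> shadow q = p -> gamma q.
Proof.
move=> Cq qp; have [Ca _] := loop_in ga.
by have [->//|[]] := inj Cq Ca qp.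
Qed.

(** Near an interior point c of C the image contains a disc, covered by points of C
    at which the height is controlled. *)
Lemma interior_disc c : C c -> U c -> ~ gamma c -> exists2 d, 0 < d &
  forall y, `|y - shadow c| < d -> exists c', [/\ C c', shadow c' = y,
    `|height c' - height c| <= enorm (y - shadow c) &
    y != shadow c -> `|height c' - height c| < enorm (y - shadow c)].
Proof.
move=> Cc Uc ngc; have Mc := off_loop_interior Cc ngc.
have [C' [U' [e' [H C'M]]]] := interior_nice cover hM hX Mc.
have Mc' := interior_subset Mc.
have C'c : C' c.
  by apply: (nice_incl H); split=> //; apply: (nice_class H) => //; left.
have [|d d0 hd] := compact_fibre_nbhs (shadow_continuous cover hX) (y := shadow c)
    (nice_compact H) oU.
  move=> c' C'c' E.
  by rewrite -(same_class_interior hM (C'M _ C'c) (nice_inj H C'c C'c' (esym E))).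
exists (Num.min d e'); first by rewrite lt_min d0 (nice_gt0 H).
move=> y; rewrite lt_min => /andP[yd ye].
have [c' C'c' c'y] := nice_surj H ye; exists c'; split=> //.
- apply: UC; split; last exact: nice_sub H _ C'c'.
  by apply: hd => //; rewrite c'y.
- by rewrite -c'y; exact: nice_lip H _ C'c'.
- rewrite -c'y => /eqP nE; apply: (nice_slip H) => //.
  by move=> /(same_class_interior hM Mc) E; apply: nE; rewrite E.
Qed.

Lemma ball_seg (y1 y2 : R * R) s : `|y1 - p| < e -> `|y2 - p| < e -> 0 <= s <= 1 ->
  `|seg y1 y2 s - p| < e.
Proof.
move=> h1 h2 /andP[s0 s1].
have -> : seg y1 y2 s - p = (1 - s) *: (y1 - p) + s *: (y2 - p).
  rewrite /seg !scalerBr !scalerBl !scale1r.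
  case: (y1) (y2) (p) => [a1 a2] [b1 b2] [p1 p2]; congr pair => /=;
    rewrite /GRing.scale /=; ring.
have n1 := normr_ge0 (y1 - p); have n2 := normr_ge0 (y2 - p).
rewrite (le_lt_trans (ler_normD _ _))// !normrZ !ger0_norm ?subr_ge0//.
have [->|s0'] := eqVneq s 0; first by rewrite subr0 mul1r mul0r addr0.
have sp : 0 < s by rewrite lt_neqAle eq_sym s0'.
have : s * `|y2 - p| < s * e by rewrite ltr_pM2l.
have : (1 - s) * `|y1 - p| <= (1 - s) * e by rewrite ler_wpM2l ?subr_ge0// ltW.
by lra.
Qed.

(** Along a segment of the punctured disc, the parameters of the points in the image
    of C form an open and closed set. *)
Lemma onto_segment c1 y2 : C c1 -> `|shadow c1 - p| < e -> `|y2 - p| < e ->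
  (forall s : R, 0 <= s <= 1 -> seg (shadow c1) y2 s != p) ->
  exists2 c, C c & shadow c = y2.
Proof.
move=> Cc1 h1 h2 avoid.
pose S := [set s : R | s \in `[0, 1] /\ exists2 c, C c & shadow c = seg (shadow c1) y2 s].
have SE : S = [set` `[0, 1]].
  apply: (@segment_connected R 0 1).
  - exists 0; split; first by rewrite /= in_itv/= ler01 lexx.
    by exists c1; rewrite ?seg0.
  - exists (interior [set s | s \in `[0, 1] -> S s]); first exact: open_interior.
    apply/seteqP; split=> s; last by case=> s01 /interior_subset/(_ s01).
    move=> [s01 [c Cc cE]]; split=> //.
    have sI : 0 <= s <= 1 by move: s01; rewrite in_itv.
    have Uc : U c by apply: hU => //; rewrite cE; exact: ball_seg.
    have ngc : ~ gamma c.
      move=> /shadow_loop; rewrite cE => /eqP; apply/negP; exact: avoid.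
    have [d d0 hd] := interior_disc Cc Uc ngc.
    have near_s : \forall s' \near s, `|seg (shadow c1) y2 s' - shadow c| < d.
      rewrite cE; have /cvgr_dist_lt/(_ d d0) := @seg_continuous _ _ (shadow c1) y2 s.
      by apply: filterS => s'; rewrite distrC.
    apply: filterS near_s => s' /hd[c' [Cc' c'E _ _]] s'01; split=> //.
    by exists c'.
  - exists (seg (shadow c1) y2 @^-1` (shadow @` C)).
      apply: preimage_closed; first by move=> z _; exact: seg_continuous.
      apply: compact_closed; first exact: norm_hausdorff.
      apply: continuous_compact => //; apply: continuous_subspaceT.
      exact: shadow_continuous cover hX.
    apply/seteqP; split=> s.
      by move=> [s01 [b Kb Fb]]; split=> //; exists b.
    by move=> [s01 [b Kb Fb]]; split=> //; exists b.
have : S 1 by rewrite SE /= in_itv/= lexx ler01.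
by move=> [_ [c Cc cE]]; exists c => //; rewrite cE seg1.
Qed.

(** Rotation by a right angle. *)
Definition rot (v : R * R) : R * R := (- v.2, v.1).

Lemma seg_center (y1 y2 : R * R) s : (seg y1 y2 s == p) =
  ((1 - s) *: (y1 - p) + s *: (y2 - p) == 0).
Proof.
rewrite -subr_eq0; congr (_ == 0).
rewrite /seg !scalerBr !scalerBl !scale1r.
case: (y1) (y2) (p) => [a1 a2] [b1 b2] [p1 p2]; congr pair => /=;
  rewrite /GRing.scale /=; ring.
Qed.

(** Any two points of the punctured disc are joined by at most two segments avoiding
    the centre: if the segment from shadow c1 to y meets p, go through
    p + rot (shadow c1 - p). *)
Lemma onto_disc y : `|y - p| < e -> exists2 c, C c & shadow c = y.
Proof.
move=> ye; have [Ca Ma] := loop_in ga.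
have [->|yp] := eqVneq y p; first by exists a.
have [c1 [Cc1 h1 n1]] : exists c1, [/\ C c1, `|shadow c1 - p| < e & shadow c1 != p].
  have : closure (interior M) a by rewrite (bs_regular hM).
  have nU : nbhs a U by apply: open_nbhs_nbhs; split=> //; exact: gU.
  have nE : \forall q \near a, `|shadow q - p| < e.
    have /cvgr_dist_lt/(_ e e0) := @shadow_continuous _ _ _ _ _ cover hX a.
    by apply: filterS => q; rewrite distrC.
  move=> /(_ _ (filterI nU nE))[b [Mb [Ub be]]].
  have Cb : C b by apply: UC; split=> //; exact: interior_subset.
  exists b; split=> //; apply/eqP => /(shadow_loopP Cb) gb.
  by have [] := loop_sub_frontier Lg gb.
pose v := shadow c1 - p; pose w := y - p.
have v0 : v != 0 by rewrite subr_eq0.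
have w0 : w != 0 by rewrite subr_eq0.
have sq (z : R * R) : z != 0 -> 0 < z.1 ^+ 2 + z.2 ^+ 2.
  move=> z0; rewrite lt_neqAle addr_ge0 ?sqr_ge0// andbT eq_sym.
  rewrite paddr_eq0 ?sqr_ge0// !sqrf_eq0; apply: contraNN z0.
  by case: z => ? ? /= /andP[/eqP-> /eqP->].
have vv := sq _ v0; have ww := sq _ w0.
have eq0 (k l : R) (x z : R * R) : k *: x + l *: z == 0 ->
    k * x.1 + l * z.1 = 0 /\ k * x.2 + l * z.2 = 0.
  by move=> /eqP[? ?].
have rot1 : (rot v).1 = - v.2 by [].
have rot2 : (rot v).2 = v.1 by [].
have [[s sI sE]|avoid] := pselect (exists2 s : R, 0 <= s <= 1 &
    seg (shadow c1) y s == p); last first.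
  apply: (onto_segment Cc1 h1 ye) => s sI; apply/negP => sE.
  by apply: avoid; exists s.
have pK z : p + z - p = z by rewrite addrC addKr.
have h2 : `|p + rot v - p| < e.
  rewrite pK; move: h1; rewrite -/v !prod_normE /rot /= normrN.
  by rewrite maxC.
have [|c2 Cc2 c2E] := onto_segment Cc1 h1 h2.
  move=> t tI; apply/negP; rewrite seg_center -/v pK addrC => /eq0.
  rewrite rot1 rot2 => -[t1 t2].
  have : ((1 - t) ^+ 2 + t ^+ 2) * (v.1 ^+ 2 + v.2 ^+ 2) = 0.
    transitivity ((t * - v.2 + (1 - t) * v.1) ^+ 2 + (t * v.1 + (1 - t) * v.2) ^+ 2).
      by ring.
    by rewrite t1 t2 expr0n addr0.
  move=> /eqP; rewrite mulf_eq0 [_ == 0]gt_eqF ?orbF; last first.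
    by have := sqr_ge0 (1 - 2 * t); lra.
  by rewrite gt_eqF.
apply: (onto_segment Cc2) => //; first by rewrite c2E.
move=> t tI; apply/negP; rewrite c2E seg_center -/w pK => /eq0.
rewrite rot1 rot2 => -[t1 t2].
move: sE; rewrite seg_center -/v -/w => /eq0[s1 s2].
have s0 : s != 0.
  apply/eqP => s0; move: s1 s2; rewrite s0 !subr0 !mul1r !mul0r !addr0 => v1 v2.
  by move: vv; rewrite v1 v2 expr0n addr0 ltxx.
have h : (1 - t) * (s * (v.1 ^+ 2 + v.2 ^+ 2)) = 0.
  transitivity (s * (v.1 * ((1 - t) * v.1 + t * w.2) - v.2 * ((1 - t) * - v.2 + t * w.1))
     - t * (v.1 * ((1 - s) * v.2 + s * w.2) - v.2 * ((1 - s) * v.1 + s * w.1))).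
    by ring.
  by rewrite t1 t2 s1 s2; ring.
have tE : t = 1.
  apply/eqP; rewrite eq_sym -subr_eq0; apply/eqP.
  apply: (mulIf (x := s * (v.1 ^+ 2 + v.2 ^+ 2))); last by rewrite h mul0r.
  by rewrite mulf_neq0// gt_eqF.
move: t1 t2 ww; rewrite tE subrr !mul0r !add0r !mul1r => -> ->.
by rewrite expr0n addr0 ltxx.
Qed.

(** Among the points c of C over the segment from p to shadow b whose height differs
    from that of b by at most the distance of the projections, take one closest to
    the vertex: it lies on the loop, because from an interior point one can still
    descend. *)
Lemma conelike_lip b : C b -> `|shadow b - p| < e ->
  `|height b - height a| <= enorm (shadow b - p).
Proof.
move=> Cb be; pose x := shadow b - p.
pose sqd (q c : T) : R := ((shadow c).1 - (shadow q).1) ^+ 2 + ((shadow c).2 - (shadow q).2) ^+ 2.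
have sqdc q : continuous (sqd q).
  move=> c; suff : {for c, continuous (sqd q)} by [].
  apply: continuousD; apply: continuous_sqrB;
    [exact: (@X_entry_continuous _ _ A M X cover hX i1 c)
    |exact: (@X_entry_continuous _ _ A M X cover hX i2 c)].
pose S := C `&` (shadow @^-1` [set seg p (shadow b) r | r in `[0, 1]] `&`
  [set c | (height c - height b) ^+ 2 - sqd b c <= 0]).
have cS : compact S.
  apply: compact_closedI => //; apply: closedI.
    exact: closed_fibre_seg (shadow_continuous cover hX) _ _ _ _.
  have -> : [set c | (height c - height b) ^+ 2 - sqd b c <= 0] =
    (fun c => (height c - height b) ^+ 2 - sqd b c) @^-1` [set t | t <= 0] by [].
  apply: preimage_closed; last exact: closed_le.
  move=> c _; have hh : {for c, continuous (fun c => (height c - height b) ^+ 2)}.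
    by apply: continuous_sqrB; exact: (@height_continuous _ _ A M X cover hX c).
  exact: (continuousB hh (sqdc b c)).
have nE c s : 0 <= s <= 1 -> shadow c = seg p (shadow b) s ->
    enorm (shadow c - shadow b) = (1 - s) * enorm x.
  move=> /andP[s0 s1] ->; rewrite -{2}(seg1 p (shadow b)) segB enormZ.
  by rewrite distrC ger0_norm// subr_ge0.
have SE c : S c -> exists s : R, [/\ 0 <= s <= 1, C c,
    shadow c = seg p (shadow b) s & `|height c - height b| <= (1 - s) * enorm x].
  move=> [Cc [[s]]]; rewrite /= in_itv/= => sI sE; rewrite subr_le0 => h.
  exists s; split=> //.
  by rewrite -(nE c s)// le_enorm.
have ES c s : 0 <= s <= 1 -> C c -> shadow c = seg p (shadow b) s ->
    `|height c - height b| <= (1 - s) * enorm x -> S c.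
  move=> sI Cc sE h; split=> //; split; first by exists s; rewrite /= ?in_itv.
  rewrite /= subr_le0 -[sqd b c]/((shadow c - shadow b).1 ^+ 2 + (shadow c - shadow b).2 ^+ 2).
  by rewrite -le_enorm (nE c s).
have Sb : S b.
  by apply: (ES b 1); rewrite ?ler01 ?lexx// ?seg1// !subrr normr0 mul0r.
have S0 : S !=set0 by exists b.
have [c /set_mem Sc hc] := compact_EVT_min S0 cS (continuous_subspaceT (sqdc a)).
have [s [sI Cc sE hs]] := SE c Sc; have [s0 s1] := andP sI.
have [cp|cp] := eqVneq (shadow c) p.
  have E : X c = X a by apply: loop_constant Lg (shadow_loopP Cc cp) ga.
  move: hs; rewrite (heightE E) distrC => /le_trans; apply.
  by rewrite ler_piMl ?sqrtr_ge0// lerBlDr lerDl.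
exfalso.
have Uc : U c.
  apply: hU => //; rewrite sE; apply: ball_seg => //.
  by rewrite subrr normr0.
have ngc : ~ gamma c by move=> /shadow_loop cp'; move/eqP: cp; apply.
have [d d0 hd] := interior_disc Cc Uc ngc.
have sp : 0 < s.
  rewrite lt_neqAle s0 andbT eq_sym; apply: contraNN cp => /eqP s00.
  by rewrite sE s00 seg0.
pose s' := Num.max 0 (s - d / (`|x| + 1) / 2).
have x0 : 0 < `|x| + 1 by rewrite ltr_wpDl.
have dx : 0 < d / (`|x| + 1) / 2 by rewrite !divr_gt0.
have s's : s' < s by rewrite gt_max sp gtrBl.
have s'0 : 0 <= s' by rewrite le_max lexx.
have s'd : s - d / (`|x| + 1) / 2 <= s' by rewrite le_max lexx orbT.
have [|c' [Cc' c'E h' _]] := hd (seg p (shadow b) s').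
  rewrite sE segB normrZ -/x ltr0_norm ?subr_lt0// opprB.
  have : (s - s') * (`|x| + 1) <= d / 2.
    rewrite -ler_pdivlMr// mulrAC; lra.
  have := normr_ge0 x; have : 0 <= s - s' by rewrite subr_ge0 ltW.
  by rewrite mulrDr mulr1; lra.
have Sc' : S c'.
  apply: (ES c' s') => //; first by rewrite s'0 (le_trans (ltW s's)).
  rewrite -(subrKA (height c)) (le_trans (ler_normD _ _))//.
  rewrite (le_trans (lerD h' hs))// sE segB enormZ -/x ltr0_norm ?subr_lt0//.
  by rewrite -mulrDl opprB addrC subrKA.
have := hc c' (mem_set Sc').
have sqdE q t : shadow q = seg p (shadow b) t ->
    sqd a q = t ^+ 2 * (x.1 ^+ 2 + x.2 ^+ 2).
  move=> qE; have E1 : shadow q - p = t *: x by rewrite qE /seg addrC addKr.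
  rewrite /sqd -[(shadow q).1 - _]/((shadow q - p).1) -[(shadow q).2 - _]/((shadow q - p).2).
  by rewrite E1 -[(t *: x).1]/(t * x.1) -[(t *: x).2]/(t * x.2); ring.
rewrite (sqdE _ _ sE) (sqdE _ _ c'E).
have xx : 0 < x.1 ^+ 2 + x.2 ^+ 2.
  rewrite lt_neqAle addr_ge0 ?sqr_ge0// andbT eq_sym paddr_eq0 ?sqr_ge0//.
  rewrite !sqrf_eq0; apply: contraNN cp => /andP[/eqP h1 /eqP h2].
  rewrite sE /seg -/x; have -> : x = 0 by case: (x) h1 h2 => ? ? /= -> ->.
  by rewrite scaler0 addr0.
by rewrite ler_pM2r// ler_pXn2r ?nnegrE// leNgt s's.
Qed.

(** The first step of the descent from the interior point b is strictly
    spacelike. *)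
Lemma conelike_slip b : C b -> U b -> `|shadow b - p| < e -> ~ gamma b ->
  `|height b - height a| < enorm (shadow b - p).
Proof.
move=> Cb Ub be ngb; pose x := shadow b - p.
have x0 : x != 0 by rewrite subr_eq0; apply/eqP => /(shadow_loopP Cb).
have xn : 0 < `|x| by rewrite normr_gt0.
have [d d0 hd] := interior_disc Cb Ub ngb.
pose s := Num.max 0 (1 - d / `|x| / 2).
have dx : 0 < d / `|x| / 2 by rewrite !divr_gt0.
have s1 : s < 1 by rewrite gt_max ltr01 gtrBl.
have s0 : 0 <= s by rewrite le_max lexx.
have sd : 1 - d / `|x| / 2 <= s by rewrite le_max lexx orbT.
have sB : seg p (shadow b) s - shadow b = (s - 1) *: x.
  by rewrite -{2}(seg1 p (shadow b)) segB.
have [|c [Cc cE _ hs]] := hd (seg p (shadow b) s).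
  rewrite sB normrZ ltr0_norm ?subr_lt0// opprB -ltr_pdivlMr//; lra.
have cp : shadow c - p = s *: x by rewrite cE /seg addrC addKr.
have := conelike_lip Cc; rewrite cp normrZ ger0_norm// => h1.
have {}h1 : `|height c - height a| <= s * enorm x.
  rewrite -[s]ger0_norm// -enormZ; apply: h1.
  by rewrite (le_lt_trans _ be)// ler_piMl// ltW.
have {}hs : `|height c - height b| < (1 - s) * enorm x.
  have -> : (1 - s) * enorm x = enorm (seg p (shadow b) s - shadow b).
    by rewrite sB enormZ ltr0_norm ?subr_lt0// opprB.
  apply: hs; rewrite -subr_eq0 sB scaler_eq0 negb_or x0 andbT subr_eq0.
  by rewrite lt_eqF.
rewrite -(subrKA (height c)) (le_lt_trans (ler_normD _ _))//.
rewrite (distrC (height b)) (lt_le_trans (ltr_leD hs h1))//.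
by rewrite -mulrDl subrK mul1r.
Qed.
End Onto.

Lemma conelike_nice gamma a : L gamma -> gamma a ->
  exists C U e, nice M same_class shadow height enorm a C U e.
Proof.
move=> Lg ga.
have [C [U [[cC CM] [oU gU] UC inj isol]]] := conelike_nbhd Lg ga.
have [|e e0 hU] := compact_fibre_nbhs (shadow_continuous cover hX) (y := shadow a) cC oU.
  by move=> c Cc /(shadow_loopP Lg ga gU UC inj Cc); exact: gU.
have e20 : 0 < e / 2 by rewrite divr_gt0.
have e2e : e / 2 < e by lra.
have shc := shadow_continuous cover hX.
have shL q : gamma q -> shadow q = shadow a by move=> gq; exact: (shadow_loop Lg ga gq).
pose f (q : T) := `|shadow q - shadow a|.
have fc : continuous f.
  move=> q; apply: (continuous_comp (f := fun q => shadow q - shadow a) (g := Num.norm)).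
    by apply: continuousB; [exact: shc|exact: cst_continuous].
  exact: norm_continuous.
have clC : closed (f @^-1` [set t | t <= e / 2]).
  by apply: preimage_closed; [move=> q _; exact: fc|exact: closed_le].
have opU : open (f @^-1` [set t | t < e / 2]).
  by apply: open_comp; [move=> q _; exact: fc|exact: open_lt].
pose C' := C `&` f @^-1` [set t | t <= e / 2].
pose U' := U `&` f @^-1` [set t | t < e / 2].
have gU' : gamma `<=` U'.
  by move=> q gq; split; [exact: gU|rewrite /preimage /= /f shL// subrr normr0].
have gM : gamma `<=` M by move=> q gq; exact/frontier_sub/(loop_sub_frontier Lg).
have U'C' : U' `&` M `<=` C'.
  by move=> q [[Uq fq] Mq]; split; [apply: UC|exact: ltW].
have class q b : C q -> same_class q b -> q = b \/ gamma q /\ gamma b.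
  move=> Cq [->|[g L' [gq gb]]]; [by left|right].
  by rewrite -(isol _ _ L' gq Cq).
have Ca : C a by apply: UC; split; [exact: gU|exact: gM].
have C'U q : C' q -> U q by move=> [Cq fq]; apply: hU => //; exact: le_lt_trans fq e2e.
exists C', U', (e / 2); split=> //.
- exact: compact_closedI.
- by move=> q [/CM].
- move=> b c C'b Mc /class[|<-//|[_ gc]]; first by case: C'b.
  by apply: U'C'; split=> //; exact: gU'.
- move=> b c [Cb _] [Cc _] /(inj _ _ Cb Cc)[->|[gb gc]]; first by left.
  by right; exists gamma.
- exact: openI.
- by move=> b Mb /(class _ _ Ca)[<-|[_ gb]]; apply: gU'.
- move=> b c U'b Mc /class[|<-//|[_ gc]]; first by have [] := U'C' _ U'b.
  by split=> //; exact: gU'.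
- move=> y ye.
  have [|c Cc cE] := onto_disc Lg ga cC CM oU gU UC inj isol e0 hU (y := y).
    exact: lt_trans ye e2e.
  by exists c => //; split=> //; rewrite /preimage /= /f cE ltW.
- move=> b [Cb fb]; apply: (conelike_lip Lg ga cC CM oU gU UC inj isol e0 hU Cb).
  exact: le_lt_trans fb e2e.
- move=> b [Cb fb] nE; have be : `|shadow b - shadow a| < e by exact: le_lt_trans fb e2e.
  apply: (conelike_slip Lg ga cC CM oU gU UC inj isol e0 hU Cb (hU _ Cb be) be).
  by move=> gb; apply: nE; right; exists gamma.
Qed.

Lemma all_nice a : M a -> exists C U e, nice M same_class shadow height enorm a C U e.
Proof.
move=> Ma; have [Mi|nMi] := pselect (interior M a).
  by have [C [U [e [H _]]]] := interior_nice cover hM hX Mi; exists C, U, e.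
have : frontier M a by split=> //; exact: subset_closure.
by rewrite (bs_frontier hM) => -[gamma Lg ga]; exact: conelike_nice ga.
Qed.
End ConelikePoints.

(** * The surface as an entire graph *)

Section GlobalShape.
Context {R : realType} {T : topologicalType}.
Variables (A : set (chart R T)) (M : set T) (L : set (set T)) (X : T -> 'rV[R]_3).
Hypotheses (cover : \bigcup_(c in A) chart_dom c = setT) (hT : hausdorff_space T)
  (hM : bordered_surface A M L) (hX : conformal_maximal_immersion A M X)
  (hproper : proper_on M X)
  (hcone : forall gamma, L gamma -> conelike_singularity A M X gamma).
Local Notation same_class := (same_class L).
Local Notation shadow := (shadow X).
Local Notation height := (height X).

(** The height is 1-Lipschitz with respect to the projection to the plane, and the
    segment between the projections of two points lifts to M. *)
Lemma entire_graph a q : M a -> M q ->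
  `|height q - height a| <= enorm (shadow q - shadow a) /\
  exists K, lift M same_class shadow (shadow a) K 0 q a.
Proof.
have FE b c : same_class b c -> shadow b = shadow c.
  by move=> /(same_classX hcone); exact: shadowE.
have uE b c : same_class b c -> height b = height c.
  by move=> /(same_classX hcone); exact: heightE.
exact: (segment_lifting hT (bs_connected hM) (fun b _ => same_class_refl L b)
  (@same_class_sym _ L) (same_class_trans hM) FE uE (shadow_continuous cover hX)
  (@enormZ R) (all_nice cover hM hX hT hproper hcone) (proper_box hproper)).
Qed.

Lemma entire_graph_inj a q : M a -> M q -> shadow q = shadow a -> same_class q a.
Proof.
move=> Ma Mq qa; have [_ [K H]] := entire_graph Ma Mq.
by apply: (lift_inj H) => //; [exact: lift_start H|exact: lift_end H].
Qed.

Lemma entire_graph_seg a q (s : R) : M a -> M q -> 0 <= s <= 1 ->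
  exists2 b, M b & shadow b = seg (shadow a) (shadow q) s.
Proof.
move=> Ma Mq sI; have [_ [K H]] := entire_graph Ma Mq.
by have [b Kb bE] := lift_onto H sI; exists b => //; exact: (lift_sub H).
Qed.

(** Distinct points of the surface, modulo the loops, are joined by a strictly
    spacelike segment: near a it is strictly spacelike by the local condition. *)
Lemma entire_graph_strict a q : M a -> M q -> ~ same_class a q ->
  `|height q - height a| < enorm (shadow q - shadow a).
Proof.
move=> Ma Mq nE; pose x := shadow q - shadow a.
have x0 : x != 0.
  rewrite subr_eq0; apply/eqP => /(entire_graph_inj Ma Mq).
  by move=> /(@same_class_sym _ L).
have xn : 0 < `|x| by rewrite normr_gt0.
have [C [U [e H]]] := all_nice cover hM hX hT hproper hcone Ma.
have e0 := nice_gt0 H.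
pose s := Num.min 1 (e / `|x| / 2).
have ex : 0 < e / `|x| / 2 by rewrite !divr_gt0.
have s0 : 0 < s by rewrite lt_min ltr01.
have s1 : s <= 1 by rewrite ge_min lexx.
have se : s <= e / `|x| / 2 by rewrite ge_min lexx orbT.
have sa : seg (shadow a) (shadow q) s - shadow a = s *: x by rewrite /seg addrC addKr.
have sq : shadow q - seg (shadow a) (shadow q) s = (1 - s) *: x.
  by rewrite -{1}(seg1 (shadow a) (shadow q)) segB.
have [|b Cb bE] := nice_surj H (y := seg (shadow a) (shadow q) s).
  by rewrite sa normrZ gtr0_norm// -ltr_pdivlMr//; lra.
have Mb := nice_sub H Cb.
have [h1 _] := entire_graph Mb Mq.
have h2 : `|height b - height a| < enorm (shadow b - shadow a).
  apply: (nice_slip H) => // ab.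
  have : s *: x == 0 by rewrite -sa -bE (shadowE (same_classX hcone ab)) subrr.
  by rewrite scaler_eq0 gt_eqF//= (negbTE x0).
rewrite -(subrKA (height b)) (le_lt_trans (ler_normD _ _))//.
rewrite (lt_le_trans (ler_ltD h1 h2))// bE sa sq !enormZ.
by rewrite (gtr0_norm s0) ger0_norm ?subr_ge0// -mulrDl subrK mul1r.
Qed.

(** The square of the Lorentzian distance from X a to X q. *)
Definition sqdist (a q : T) : R := lorentz (X q - X a) (X q - X a).

Lemma sqdistE a q : sqdist a q = (X q 0 i1 - X a 0 i1) ^+ 2 +
  (X q 0 i2 - X a 0 i2) ^+ 2 - (X q 0 i3 - X a 0 i3) ^+ 2.
Proof. by rewrite /sqdist /lorentz !mxE !expr2. Qed.

Lemma sqdist_gt0 a q : M a -> M q -> ~ same_class a q -> 0 < sqdist a q.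
Proof.
move=> Ma Mq /(entire_graph_strict Ma Mq).
by rewrite lt_enorm sqdistE subr_gt0.
Qed.

Lemma sqdist_continuous a : continuous (sqdist a).
Proof.
have E : sqdist a = (fun q => (X q 0 i1 - X a 0 i1) ^+ 2 +
  (X q 0 i2 - X a 0 i2) ^+ 2 - (X q 0 i3 - X a 0 i3) ^+ 2).
  by apply/funext => q; exact: sqdistE.
move=> q; have h j : {for q, continuous (fun q => (X q 0 j - X a 0 j) ^+ 2)}.
  by apply: continuous_sqrB; exact: (@X_entry_continuous _ _ A M X cover hX j q).
by rewrite E; exact: (continuousB (continuousD (h i1) (h i2)) (h i3)).
Qed.

(** Let r be the distance of the projections to that of a, and h the absolute value of
    the difference of the heights. Along the ray through q the quantity r - h does
    not decrease, and it has a positive minimum d on the unit circle; so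
    sqdist = (r - h) (r + h) is at least d r outside the circle. *)
Lemma sqdist_proper a (t : R) : M a -> compact (M `&` [set q | sqdist a q <= t]).
Proof.
move=> Ma; pose r q := enorm (shadow q - shadow a).
have r2 q : r q ^+ 2 = (X q 0 i1 - X a 0 i1) ^+ 2 + (X q 0 i2 - X a 0 i2) ^+ 2.
  by rewrite /r /enorm sqr_sqrtr// addr_ge0 ?sqr_ge0.
have r0 q : 0 <= r q by exact: sqrtr_ge0.
have bound q B : M q -> r q <= B -> (M `&` [set q |
    `|shadow q| <= `|shadow a| + `|height a| + B /\
    `|height q| <= `|shadow a| + `|height a| + B]) q.
  move=> Mq rB; split=> //; have [h _] := entire_graph Ma Mq.
  have nr : `|shadow q - shadow a| <= r q.
    rewrite prod_normE ge_max; apply/andP.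
    by split; rewrite /r le_enorm ?lerDl ?lerDr sqr_ge0.
  have := ler_normD (shadow q - shadow a) (shadow a); rewrite subrK.
  have := ler_normD (height q - height a) (height a); rewrite subrK.
  have := normr_ge0 (shadow a); have := normr_ge0 (height a).
  by move=> ? ? ? ?; rewrite -/(r q) in h; split; lra.
pose S := (M `&` [set q | `|shadow q| <= `|shadow a| + `|height a| + 1 /\
    `|height q| <= `|shadow a| + `|height a| + 1]) `&`
  [set q | (X q 0 i1 - X a 0 i1) ^+ 2 + (X q 0 i2 - X a 0 i2) ^+ 2 = 1].
have cf j : continuous (fun q => (X q 0 j - X a 0 j) ^+ 2).
  move=> q; suff : {for q, continuous (fun q => (X q 0 j - X a 0 j) ^+ 2)} by [].
  by apply: continuous_sqrB; exact: (@X_entry_continuous _ _ A M X cover hX j q).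
have cS : compact S.
  apply: compact_closedI; first exact: proper_box.
  have -> : [set q | (X q 0 i1 - X a 0 i1) ^+ 2 + (X q 0 i2 - X a 0 i2) ^+ 2 = 1] =
    (fun q => (X q 0 i1 - X a 0 i1) ^+ 2 + (X q 0 i2 - X a 0 i2) ^+ 2) @^-1` [set 1] by [].
  apply: preimage_closed; last exact: closed_eq.
  by move=> q _; exact: (continuousD (cf i1 q) (cf i2 q)).
have S1 q : M q -> r q = 1 -> S q.
  move=> Mq rq; split; first by apply: bound => //; rewrite rq.
  by rewrite /= -r2 rq expr1n.
have [d [d0 d1 hd]] : exists d, [/\ 0 < d, d <= 1 &
    forall q, S q -> d <= 1 - `|height q - height a|].
  have [->|/set0P S0] := eqVneq S set0; first by exists 1; split.
  have hc : {within S, continuous (fun q => 1 - `|height q - height a|)}.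
    apply: continuous_subspaceT => q.
    have h1 : {for q, continuous (fun q => `|height q - height a|)}.
      apply: (continuous_comp (f := fun q => height q - height a) (g := Num.norm)).
        apply: continuousB; last exact: cst_continuous.
        exact: (@height_continuous _ _ A M X cover hX q).
      exact: norm_continuous.
    have h2 : {for q, continuous (fun _ : T => 1 : R)} by exact: cst_continuous.
    exact: (continuousB h2 h1).
  have [b /set_mem Sb hb] := compact_EVT_min S0 cS hc.
  exists (1 - `|height b - height a|); split.
  - rewrite subr_gt0; case: Sb => -[Mb _] /= rb.
    have E : enorm (shadow b - shadow a) = 1 by rewrite /enorm rb sqrtr1.
    rewrite -E; apply: entire_graph_strict => // ab.
    have := E; rewrite (shadowE (same_classX hcone ab)) subrr /enorm /= !expr0n addr0 sqrtr0.
    by move=> /eqP; rewrite eq_sym oner_eq0.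
  - by rewrite gerBl.
  - by move=> q Sq; apply: hb; exact: mem_set.
have grow q : M q -> 1 <= r q -> d * r q <= sqdist a q.
  move=> Mq rq; have rpos : 0 < r q by exact: lt_le_trans ltr01 rq.
  have [|b Mb bE] := @entire_graph_seg a q (r q)^-1 Ma Mq.
    by rewrite invr_ge0 ltW//= invf_le1.
  have rb : r b = 1.
    rewrite /r bE /seg [_ + _ *: _]addrC addrK enormZ -/(r q).
    by rewrite ger0_norm ?invr_ge0 ?ltW// mulVf ?gt_eqF.
  have hb := hd _ (S1 _ Mb rb).
  have [hq _] := entire_graph Mb Mq.
  have : `|height q - height b| <= r q - 1.
    move: hq; rewrite bE -{1}(seg1 (shadow a) (shadow q)) segB enormZ -/(r q).
    have ir : 0 <= 1 - (r q)^-1 by rewrite subr_ge0 invf_le1.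
    by rewrite (ger0_norm ir) mulrBl mul1r mulVf ?gt_eqF.
  have : `|height q - height a| <= `|height q - height b| + `|height b - height a|.
    by rewrite -(subrKA (height b)) ler_normD.
  move=> t1 t2; have t3 : `|height q - height a| <= r q - d by lra.
  rewrite sqdistE -r2 -[X q 0 i3 - _]/(height q - height a).
  have : (height q - height a) ^+ 2 <= (r q - d) ^+ 2.
    by rewrite -(real_normK (num_real (height q - height a))) ler_pXn2r ?nnegrE// (le_trans _ t3).
  have -> : (r q - d) ^+ 2 = r q ^+ 2 - d * (2 * r q - d) by ring.
  have : d * r q <= d * (2 * r q - d) by rewrite ler_pM2l//; lra.
  by lra.
pose B := `|t| / d + 1.
apply: (subclosed_compact _ (@proper_box _ _ _ _ hproper (`|shadow a| + `|height a| + B))).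
  apply: closedI; first exact: bs_closed hM.
  have -> : [set q | sqdist a q <= t] = sqdist a @^-1` [set s | s <= t] by [].
  by apply: preimage_closed; [move=> q _; exact: sqdist_continuous|exact: closed_le].
move=> q [Mq qt]; apply: bound => //.
have td : 0 <= `|t| / d by rewrite divr_ge0// ltW.
have [r1|/ltW r1] := leP 1 (r q); last by rewrite /B; lra.
have h := le_trans (grow q Mq r1) qt.
have : r q <= `|t| / d by rewrite ler_pdivlMr// mulrC (le_trans h)// ler_norm.
by rewrite /B; lra.
Qed.
End GlobalShape.

(** * Second derivatives and Lorentzian algebra *)

Section SecondDerivatives.
Context {R : realType}.
Implicit Types (h dh : R -> R).

(** The second derivative at a local maximum is at most 0. *)
Lemma local_max_second_derivative h dh (r d : R) : 0 < r ->
  (forall t : R, `|t| < r -> is_derive t 1 h (dh t)) ->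
  is_derive (0 : R) 1 dh d -> (forall t : R, `|t| < r -> h t <= h 0) -> d <= 0.
Proof.
move=> r0 H H2 hmax; rewrite leNgt; apply/negP => d0.
have dh0 : dh 0 = 0.
  apply/eqP; rewrite -oppr_eq0; apply/eqP.
  apply: (@local_min_derive _ (fun t => - h t) (fun t => - dh t) r) => // t tr.
    exact: is_deriveN (H t tr).
  by rewrite lerN2; exact: hmax.
have [dv dE] := H2.
have lim : (k^-1 *: ((dh \o shift 0) (k *: (1 : R)) - dh 0)) @[k --> 0^'] --> d.
  by rewrite -dE; exact: dv.
have d20 : 0 < d / 2 by rewrite divr_gt0.
have : \forall k \near 0^',
    `|d - k^-1 *: ((dh \o shift 0) (k *: (1 : R)) - dh 0)| < d / 2.
  by move/cvgr_dist_lt: lim; exact.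
rewrite /dnbhs near_withinE => /nbhs_ballP[e /= e0 he].
have pos (s : R) : 0 < s -> s < e -> 0 < dh s.
  move=> s0 se.
  have : `|d - s^-1 *: ((dh \o shift 0) (s *: (1 : R)) - dh 0)| < d / 2.
    apply: he; last by rewrite gt_eqF.
    by rewrite -ball_normE /ball_ /= sub0r normrN gtr0_norm.
  rewrite /= addr0 dh0 subr0 [s *: 1]mulr1 ltr_distlC => /andP[lo _].
  have : 0 < s^-1 * dh s by apply: (lt_trans _ lo); lra.
  by rewrite pmulr_rgt0// invr_gt0.
pose s := Num.min r e / 2.
have s0 : 0 < s by rewrite divr_gt0// lt_min r0.
have [sr se] : s < r /\ s < e.
  have m1 : Num.min r e <= r by rewrite ge_min lexx.
  have m2 : Num.min r e <= e by rewrite ge_min lexx orbT.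
  have : 0 < Num.min r e by rewrite lt_min r0.
  by rewrite /s; lra.
have D t : 0 <= t <= s -> is_derive t 1 h (dh t).
  by move=> /andP[t0 ts]; apply: H; rewrite ger0_norm// (le_lt_trans ts).
have hc : {within [set` `[0, s]], continuous h}.
  apply: derivable_within_continuous => t; rewrite in_itv/= => tI.
  by have [] := D t tI.
have D' t : t \in `]0, s[ -> is_derive t 1 h (dh t).
  by rewrite in_itv/= => /andP[t0 ts]; apply: D; rewrite !ltW.
have [t] := MVT s0 D' hc; rewrite in_itv/= subr0 => /andP[t0 ts] hs.
have : h s <= h 0 by apply: hmax; rewrite gtr0_norm.
by rewrite -subr_le0 hs leNgt mulr_gt0// pos// (lt_trans ts).
Qed.

Lemma is_derive_form (u1 u2 u3 v1 v2 v3 : R -> R) (t a1 a2 a3 b1 b2 b3 : R) :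
  is_derive t 1 u1 a1 -> is_derive t 1 u2 a2 -> is_derive t 1 u3 a3 ->
  is_derive t 1 v1 b1 -> is_derive t 1 v2 b2 -> is_derive t 1 v3 b3 ->
  is_derive t 1 (fun s => u1 s * v1 s + u2 s * v2 s - u3 s * v3 s)
    (a1 * v1 t + u1 t * b1 + (a2 * v2 t + u2 t * b2) - (a3 * v3 t + u3 t * b3)).
Proof.
move=> ? ? ? ? ? ?; apply: is_derive_eq.
by rewrite /GRing.scale /=; ring.
Qed.

Lemma is_derive_subr (u : R -> R) (t a k : R) :
  is_derive t 1 u a -> is_derive t 1 (fun s => u s - k) a.
Proof. by move=> ?; apply: is_derive_eq; rewrite subr0. Qed.

Lemma is_derive_near0 (u : R -> R) (t a : R) :
  (\forall s \near t, u s = 0) -> is_derive t 1 u a -> a = 0.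
Proof.
move=> u0 du; have ud : is_derive t 1 (cst 0 : R -> R) a.
  exact: near_eq_is_derive u0 du.
by have [_ <-] := ud; rewrite derive_cst.
Qed.

(** First derivative of k f - e ln z + n z. *)
Lemma is_derive_barrier (k e n : R) (f z : R -> R) (t f' z' : R) :
  is_derive t 1 f f' -> is_derive t 1 z z' -> 0 < z t ->
  is_derive t 1 (fun s => k * f s - e * ln (z s) + n * z s)
    (k * f' - e * ((z t)^-1 * z') + n * z').
Proof.
move=> df dz zt; have dl : is_derive t 1 (fun s => ln (z s)) ((z t)^-1 * z').
  exact: (is_derive1_comp (is_derive1_ln zt) dz).
by apply: is_derive_eq; rewrite /GRing.scale /=; ring.
Qed.

(** Derivative of the expression of the previous lemma, with z1 for z'. *)
Lemma is_derive_barrier' (k e n : R) (f z z1 : R -> R) (t f' z' z1' : R) :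
  is_derive t 1 f f' -> is_derive t 1 z z' -> is_derive t 1 z1 z1' -> z t != 0 ->
  is_derive t 1 (fun s => k * f s - e * ((z s)^-1 * z1 s) + n * z1 s)
    (k * f' - e * ((z t)^-1 * z1' - (z t) ^- 2 * z' * z1 t) + n * z1').
Proof.
move=> df dz dz1 zt.
have dv : is_derive t 1 (fun s => (z s)^-1) (- (z t) ^- 2 *: z').
  exact: is_deriveV.
by apply: is_derive_eq; rewrite /GRing.scale /=; ring.
Qed.

(** In Lorentz space a vector W orthogonal to a spacelike plane and to its normal
    vanishes: for every V, the product of det (P, Q, V) and det (P, Q, W) is minus
    a Gram determinant, which here reduces to l^2 <V, W>. *)
Lemma lorentz_orthogonal (l P1 P2 P3 Q1 Q2 Q3 W1 W2 W3 : R) : l != 0 ->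
  P1 ^+ 2 + P2 ^+ 2 - P3 ^+ 2 = l -> Q1 ^+ 2 + Q2 ^+ 2 - Q3 ^+ 2 = l ->
  P1 * Q1 + P2 * Q2 - P3 * Q3 = 0 ->
  W1 * P1 + W2 * P2 - W3 * P3 = 0 -> W1 * Q1 + W2 * Q2 - W3 * Q3 = 0 ->
  W1 * (P2 * Q3 - P3 * Q2) + W2 * (P3 * Q1 - P1 * Q3) + W3 * (P1 * Q2 - P2 * Q1) = 0 ->
  [/\ W1 = 0, W2 = 0 & W3 = 0].
Proof.
move=> l0 hP hQ hPQ wP wQ wn.
have key (V1 V2 V3 : R) : V1 * W1 + V2 * W2 - V3 * W3 = 0.
  have gram : (V1 * (P2 * Q3 - P3 * Q2) + V2 * (P3 * Q1 - P1 * Q3) + V3 * (P1 * Q2 - P2 * Q1)) *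
    (W1 * (P2 * Q3 - P3 * Q2) + W2 * (P3 * Q1 - P1 * Q3) + W3 * (P1 * Q2 - P2 * Q1)) =
    - ((P1 ^+ 2 + P2 ^+ 2 - P3 ^+ 2) * ((Q1 ^+ 2 + Q2 ^+ 2 - Q3 ^+ 2) * (V1 * W1 + V2 * W2 - V3 * W3)
        - (W1 * Q1 + W2 * Q2 - W3 * Q3) * (V1 * Q1 + V2 * Q2 - V3 * Q3))
      - (P1 * Q1 + P2 * Q2 - P3 * Q3) * ((P1 * Q1 + P2 * Q2 - P3 * Q3) * (V1 * W1 + V2 * W2 - V3 * W3)
        - (W1 * Q1 + W2 * Q2 - W3 * Q3) * (V1 * P1 + V2 * P2 - V3 * P3))
      + (W1 * P1 + W2 * P2 - W3 * P3) * ((P1 * Q1 + P2 * Q2 - P3 * Q3) * (V1 * Q1 + V2 * Q2 - V3 * Q3)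
        - (Q1 ^+ 2 + Q2 ^+ 2 - Q3 ^+ 2) * (V1 * P1 + V2 * P2 - V3 * P3))).
    by ring.
  move: gram; rewrite hP hQ hPQ wP wQ wn !mulr0 !mul0r !subr0 addr0 => /eqP.
  by rewrite eq_sym oppr_eq0 !mulf_eq0 (negbTE l0)/= => /eqP.
have := key 1 0 0; have := key 0 1 0; have := key 0 0 1.
rewrite !mul1r !mul0r !addr0 ?add0r ?subr0 ?sub0r => /eqP.
by rewrite oppr_eq0 => /eqP -> -> ->.
Qed.

(** The reverse Bessel inequality for an orthogonal spacelike pair: the Gram
    determinant of P, Q, V is minus the square of det (P, Q, V). *)
Lemma lorentz_bessel (l P1 P2 P3 Q1 Q2 Q3 V1 V2 V3 : R) : 0 < l ->
  P1 ^+ 2 + P2 ^+ 2 - P3 ^+ 2 = l -> Q1 ^+ 2 + Q2 ^+ 2 - Q3 ^+ 2 = l ->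
  P1 * Q1 + P2 * Q2 - P3 * Q3 = 0 ->
  l * (V1 ^+ 2 + V2 ^+ 2 - V3 ^+ 2) <=
    (V1 * P1 + V2 * P2 - V3 * P3) ^+ 2 + (V1 * Q1 + V2 * Q2 - V3 * Q3) ^+ 2.
Proof.
move=> l0 hP hQ hPQ.
have gram : (V1 * (P2 * Q3 - P3 * Q2) + V2 * (P3 * Q1 - P1 * Q3) + V3 * (P1 * Q2 - P2 * Q1)) ^+ 2 =
    - ((P1 ^+ 2 + P2 ^+ 2 - P3 ^+ 2) * ((Q1 ^+ 2 + Q2 ^+ 2 - Q3 ^+ 2) * (V1 ^+ 2 + V2 ^+ 2 - V3 ^+ 2)
        - (V1 * Q1 + V2 * Q2 - V3 * Q3) ^+ 2)
      - (P1 * Q1 + P2 * Q2 - P3 * Q3) * ((P1 * Q1 + P2 * Q2 - P3 * Q3) * (V1 ^+ 2 + V2 ^+ 2 - V3 ^+ 2)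
        - (V1 * Q1 + V2 * Q2 - V3 * Q3) * (V1 * P1 + V2 * P2 - V3 * P3))
      + (V1 * P1 + V2 * P2 - V3 * P3) * ((P1 * Q1 + P2 * Q2 - P3 * Q3) * (V1 * Q1 + V2 * Q2 - V3 * Q3)
        - (Q1 ^+ 2 + Q2 ^+ 2 - Q3 ^+ 2) * (V1 * P1 + V2 * P2 - V3 * P3))).
  by ring.
have := sqr_ge0 (V1 * (P2 * Q3 - P3 * Q2) + V2 * (P3 * Q1 - P1 * Q3) + V3 * (P1 * Q2 - P2 * Q1)).
rewrite gram hP hQ hPQ !mul0r sub0r.
set vP := V1 * P1 + _ - _; set vQ := V1 * Q1 + _ - _; set vv := V1 ^+ 2 + _ - _.
move=> h; rewrite -(ler_pM2l l0).
by move: h; rewrite !expr2; lra.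
Qed.
End SecondDerivatives.

(** * The maximum principle *)

Section MaximumPrinciple.
Context {R : realType} {T : topologicalType}.
Variables (A : set (chart R T)) (M : set T) (X : T -> 'rV[R]_3).
Hypotheses (cover : \bigcup_(c in A) chart_dom c = setT)
  (hX : conformal_maximal_immersion A M X).
Implicit Types (c : chart R T) (j : 'I_3) (p : R * R).
Local Notation entry := (entry X).
Local Notation entry1 := (entry1 X).
Local Notation entry2 := (entry2 X).
Local Notation entry11 := (entry11 X).
Local Notation entry12 := (entry12 X).
Local Notation entry21 := (entry21 X).
Local Notation entry22 := (entry22 X).

(** The Lorentz product of two triples. *)
Definition dot (u v : 'I_3 -> R) : R := u i1 * v i1 + u i2 * v i2 - u i3 * v i3.

Lemma is_derive_line0 (g : R * R -> R) p e (a : R) :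
  is_derive p e g a -> is_derive (0 : R) 1 (fun s => g (p + s *: e)) a.
Proof. by move=> H; apply: is_derive_line; rewrite scale0r addr0. Qed.

Lemma line_near p e (D : set (R * R)) : nbhs p D ->
  exists2 r : R, 0 < r & forall t : R, `|t| < r -> D (p + t *: e).
Proof.
move=> /nbhs_boxP[r r0 rD]; have [d d0 hd] := box_line p e r0.
by exists d => // t /hd/rD.
Qed.

Lemma near0_lt (r : R) : 0 < r -> \forall s \near (0 : R), `|s| < r.
Proof.
move=> r0; apply/nbhs_ballP; exists r => // s.
by rewrite -ball_normE /ball_ /= sub0r normrN.
Qed.

(** Derivatives in a direction e of the relations <X1, X1> = <X2, X2> and
    <X1, X2> = 0 between the partial derivatives of X. *)
Lemma conformal_derive c p e (P' Q' : 'I_3 -> R) : A c -> coord_image c setT p ->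
  (forall j, is_derive p e (entry1 c j) (P' j)) ->
  (forall j, is_derive p e (entry2 c j) (Q' j)) ->
  dot P' (entry1 c ^~ p) = dot Q' (entry2 c ^~ p) /\
  dot P' (entry2 c ^~ p) + dot (entry1 c ^~ p) Q' = 0.
Proof.
move=> Ac Dp dP dQ.
have pD : nbhs p (coord_image c setT).
  by apply: open_nbhs_nbhs; split=> //; apply/coord_image_open/openT.
have [r r0 hr] := line_near e pD.
have nD : \forall s \near (0 : R), coord_image c setT (p + s *: e).
  by apply: filterS (near0_lt r0) => s; exact: hr.
have lP j := is_derive_line0 (dP j); have lQ j := is_derive_line0 (dQ j).
split.
- have H := is_derive_sub (is_derive_form (lP i1) (lP i2) (lP i3) (lP i1) (lP i2) (lP i3))
    (is_derive_form (lQ i1) (lQ i2) (lQ i3) (lQ i1) (lQ i2) (lQ i3)).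
  have : \forall s \near (0 : R), entry1 c i1 (p + s *: e) * entry1 c i1 (p + s *: e) +
      entry1 c i2 (p + s *: e) * entry1 c i2 (p + s *: e) -
      entry1 c i3 (p + s *: e) * entry1 c i3 (p + s *: e) -
      (entry2 c i1 (p + s *: e) * entry2 c i1 (p + s *: e) +
      entry2 c i2 (p + s *: e) * entry2 c i2 (p + s *: e) -
      entry2 c i3 (p + s *: e) * entry2 c i3 (p + s *: e)) = 0.
    apply: filterS nD => s Ds; have [l _ [h1 h2 _]] := conformal_at hX Ac Ds.
    move: (entry1 c i1 _) (entry1 c i2 _) (entry1 c i3 _) (entry2 c i1 _)
      (entry2 c i2 _) (entry2 c i3 _) h1 h2 => P1 P2 P3 Q1 Q2 Q3 h1 h2.
    by rewrite -!expr2 h1 h2 subrr.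
  move=> /is_derive_near0/(_ H); rewrite !scale0r !addr0 /dot => h.
  by lra.
- have H := is_derive_form (lP i1) (lP i2) (lP i3) (lQ i1) (lQ i2) (lQ i3).
  have : \forall s \near (0 : R), entry1 c i1 (p + s *: e) * entry2 c i1 (p + s *: e) +
      entry1 c i2 (p + s *: e) * entry2 c i2 (p + s *: e) -
      entry1 c i3 (p + s *: e) * entry2 c i3 (p + s *: e) = 0.
    by apply: filterS nD => s Ds; have [l _ [_ _ h]] := conformal_at hX Ac Ds.
  move=> /is_derive_near0/(_ H); rewrite !scale0r !addr0 /dot => h.
  by rewrite -[RHS]h; ring.
Qed.

(** Vanishing mean curvature, in conformal coordinates: the Laplacian W of X is
    orthogonal to the normal. *)
Lemma mean_curvature_normal c p : A c -> coord_image c (interior M) p ->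
  let W j := entry11 c j p + entry22 c j p in
  W i1 * (entry1 c i2 p * entry2 c i3 p - entry1 c i3 p * entry2 c i2 p) +
  W i2 * (entry1 c i3 p * entry2 c i1 p - entry1 c i1 p * entry2 c i3 p) +
  W i3 * (entry1 c i1 p * entry2 c i2 p - entry1 c i2 p * entry2 c i1 p) = 0.
Proof.
move=> Ac Dp W.
have [l l0 [hP hQ hPQ]] := interior_conformal_at hX Ac Dp.
have [q [cq Mq] qp] := Dp.
have [l' _ FF] := cmi_conformal hX Ac cq.
have l'E : l' = l.
  have := FF e1 e1; rewrite /e1 /= !mulr1 mulr0 addr0 mulr1 => <-.
  by rewrite -hP /first_form /lorentz qp !expr2.
have H0 := cmi_maximal hX Mq Ac cq.
have i21 : (i2 == i1) = false by rewrite -val_eqE /= !inordK.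
have i31 : (i3 == i1) = false by rewrite -val_eqE /= !inordK.
have i32 : (i3 == i2) = false by rewrite -val_eqE /= !inordK.
pose n := lorentz_cross ('D_e1 (local_expr c X) p) ('D_e2 (local_expr c X) p).
have n1 : n 0 i1 = entry1 c i2 p * entry2 c i3 p - entry1 c i3 p * entry2 c i2 p.
  by rewrite mxE eqxx.
have n2 : n 0 i2 = entry1 c i3 p * entry2 c i1 p - entry1 c i1 p * entry2 c i3 p.
  by rewrite mxE i21 eqxx.
have n3 : n 0 i3 = - (entry1 c i1 p * entry2 c i2 p - entry1 c i2 p * entry2 c i1 p).
  by rewrite mxE i31 i32.
have nn : - lorentz n n = l ^+ 2.
  rewrite /lorentz n1 n2 n3.
  move: (entry1 c i1 p) (entry1 c i2 p) (entry1 c i3 p) (entry2 c i1 p)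
    (entry2 c i2 p) (entry2 c i3 p) hP hQ hPQ => P1 P2 P3 Q1 Q2 Q3 hP hQ hPQ.
  transitivity ((P1 ^+ 2 + P2 ^+ 2 - P3 ^+ 2) * (Q1 ^+ 2 + Q2 ^+ 2 - Q3 ^+ 2) -
    (P1 * Q1 + P2 * Q2 - P3 * Q3) ^+ 2); first by ring.
  by rewrite hP hQ hPQ; ring.
pose k := (Num.sqrt (- lorentz n n))^-1.
have k0 : k != 0 by rewrite /k nn sqrtr_sqr gtr0_norm// invr_eq0 gt_eqF.
have un : unit_normal X c q = k *: n by rewrite /unit_normal qp.
have sf v : second_form X c q v v = k * lorentz ('D_v ('D_v (local_expr c X)) p) n.
  by rewrite /second_form un qp /lorentz !mxE; ring.
have alg (s t : R) : (l * s - 2 * 0 * 0 + l * t) / (2 * (l * l - 0 ^+ 2)) = 0 -> s + t = 0.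
  rewrite mulr0 expr0n !subr0 -mulrDr => /eqP.
  rewrite mulf_eq0 invr_eq0 !mulf_eq0 pnatr_eq0 (gt_eqF l0) /= orbF => /eqP.
  by [].
have S0 : second_form X c q e1 e1 + second_form X c q e2 e2 = 0.
  apply: alg; rewrite -[RHS]H0 /mean_curvature !FF l'E /e1 /e2 /=.
  by rewrite !(mulr1, mulr0, mul0r, addr0, add0r).
move: S0; rewrite (sf e1) (sf e2).
set V1 := 'D_e1 ('D_e1 _) p; set V2 := 'D_e2 ('D_e2 _) p.
have W12 j : W j = V1 0 j + V2 0 j by [].
rewrite -mulrDr => /eqP; rewrite mulf_eq0 (negbTE k0) /= => /eqP.
rewrite /lorentz n1 n2 n3 !W12; clearbody V1 V2.
move: (entry1 c i1 p) (entry1 c i2 p) (entry1 c i3 p) (entry2 c i1 p)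
    (entry2 c i2 p) (entry2 c i3 p) => P1 P2 P3 Q1 Q2 Q3 h.
by rewrite -[RHS]h; ring.
Qed.

(** The coordinate functions are harmonic: the Laplacian of X is orthogonal to the
    tangent plane by conformality, and to the normal by vanishing mean
    curvature. *)
Lemma entry_harmonic c p j : A c -> coord_image c (interior M) p ->
  entry11 c j p + entry22 c j p = 0.
Proof.
move=> Ac Dp.
have oD : open (coord_image c setT) by apply/coord_image_open/openT.
have DT : coord_image c setT p by case: Dp => q [cq _] <-; exists q.
have mix i : entry12 c i p = entry21 c i p.
  exact: (mixed_partials oD DT (entry_C1 hX i Ac) (entry1_C1 hX i Ac) (entry2_C1 hX i Ac)).
have [E1 F1] := conformal_derive (P' := entry11 c ^~ p) (Q' := entry21 c ^~ p) Ac DT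
  (fun i => let: And5 h _ _ _ _ := entry1_C1 hX i Ac DT in h)
  (fun i => let: And5 h _ _ _ _ := entry2_C1 hX i Ac DT in h).
have [E2 F2] := conformal_derive (P' := entry12 c ^~ p) (Q' := entry22 c ^~ p) Ac DT
  (fun i => let: And5 _ h _ _ _ := entry1_C1 hX i Ac DT in h)
  (fun i => let: And5 _ h _ _ _ := entry2_C1 hX i Ac DT in h).
have [l l0 [hP hQ hPQ]] := interior_conformal_at hX Ac Dp.
have := mean_curvature_normal Ac Dp.
move: E1 F1 E2 F2; rewrite /dot !mix => E1 F1 E2 F2 N.
have l0' : l != 0 by rewrite gt_eqF.
have [||W1 W2 W3] := lorentz_orthogonal l0' hP hQ hPQ _ _ N.
- by rewrite !mulrDl; lra.
- by rewrite !mulrDl; lra.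
by have [->|[->|->]] := ord3_cases j.
Qed.

Lemma is_derive_square_form (u1 u2 u3 : R -> R) (t a1 a2 a3 : R) :
  is_derive t 1 u1 a1 -> is_derive t 1 u2 a2 -> is_derive t 1 u3 a3 ->
  is_derive t 1 (fun s => u1 s * u1 s + u2 s * u2 s - u3 s * u3 s)
    (2 * (u1 t * a1 + u2 t * a2 - u3 t * a3)).
Proof.
move=> ? ? ?; apply: is_derive_eq.
by rewrite /GRing.scale /=; ring.
Qed.

Lemma is_derive_double_form (u1 u2 u3 v1 v2 v3 : R -> R) (t a1 a2 a3 b1 b2 b3 : R) :
  is_derive t 1 u1 a1 -> is_derive t 1 u2 a2 -> is_derive t 1 u3 a3 ->
  is_derive t 1 v1 b1 -> is_derive t 1 v2 b2 -> is_derive t 1 v3 b3 ->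
  is_derive t 1 (fun s => 2 * (u1 s * v1 s + u2 s * v2 s - u3 s * v3 s))
    (2 * (a1 * v1 t + a2 * v2 t - a3 * v3 t + (u1 t * b1 + u2 t * b2 - u3 t * b3))).
Proof.
move=> ? ? ? ? ? ?; apply: is_derive_eq.
by rewrite /GRing.scale /=; ring.
Qed.

(** Second derivative, in a direction e, of k g - eps ln z + eta z at a local
    maximum, for z the square of the Lorentzian distance to x0. *)
Lemma barrier_second_derivative (D : set (R * R)) (x f1 : 'I_3 -> R * R -> R)
    (g g1 : R * R -> R) p e (x0 x11 : 'I_3 -> R) (g11 k eps eta : R) :
  nbhs p D ->
  (forall j p', D p' -> is_derive p' e (x j) (f1 j p')) ->
  (forall j, is_derive p e (f1 j) (x11 j)) ->
  (forall p', D p' -> is_derive p' e g (g1 p')) -> is_derive p e g1 g11 ->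
  let V j p' := x j p' - x0 j in
  let z p' := V i1 p' * V i1 p' + V i2 p' * V i2 p' - V i3 p' * V i3 p' in
  let z1 := 2 * dot (V ^~ p) (f1 ^~ p) in
  let z11 := 2 * (dot (f1 ^~ p) (f1 ^~ p) + dot (V ^~ p) x11) in
  (forall p', D p' -> 0 < z p') ->
  (forall p', D p' -> k * g p' - eps * ln (z p') + eta * z p' <=
     k * g p - eps * ln (z p) + eta * z p) ->
  k * g11 - eps * ((z p)^-1 * z11 - (z p) ^- 2 * z1 * z1) + eta * z11 <= 0.
Proof.
move=> pD dx dx1 dg dg1 V z z1 z11 zpos hmax.
have [r r0 hr] := line_near e pD.
have p0 : p + (0 : R) *: e = p by rewrite scale0r addr0.
have zp : z p != 0 by rewrite gt_eqF// zpos//; exact: nbhs_singleton.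
have dV j (t : R) : `|t| < r -> is_derive t 1 (fun s => V j (p + s *: e)) (f1 j (p + t *: e)).
  by move=> tr; apply: is_derive_subr; apply: is_derive_line; apply: dx; exact: hr.
have dV0 j : is_derive (0 : R) 1 (fun s => V j (p + s *: e)) (f1 j p).
  by rewrite -[in f1 j p]p0; apply: dV; rewrite normr0.
have dF j : is_derive (0 : R) 1 (fun s => f1 j (p + s *: e)) (x11 j).
  exact: is_derive_line0.
pose h s := k * g (p + s *: e) - eps * ln (z (p + s *: e)) + eta * z (p + s *: e).
pose Z1 s := 2 * (V i1 (p + s *: e) * f1 i1 (p + s *: e) +
  V i2 (p + s *: e) * f1 i2 (p + s *: e) - V i3 (p + s *: e) * f1 i3 (p + s *: e)).
pose dh s := k * g1 (p + s *: e) - eps * ((z (p + s *: e))^-1 * Z1 s) + eta * Z1 s.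
have dz (t : R) : `|t| < r -> is_derive t 1 (fun s => z (p + s *: e)) (Z1 t).
  move=> tr; exact: is_derive_square_form (dV i1 t tr) (dV i2 t tr) (dV i3 t tr).
have dZ1 : is_derive (0 : R) 1 Z1 z11.
  have := is_derive_double_form (dV0 i1) (dV0 i2) (dV0 i3) (dF i1) (dF i2) (dF i3).
  by rewrite p0.
have Z10 : Z1 0 = z1 by rewrite /Z1 p0.
apply: (@local_max_second_derivative _ h dh r _ r0).
- move=> t tr; apply: is_derive_barrier; last by apply: zpos; exact: hr.
    by apply: is_derive_line; apply: dg; exact: hr.
  exact: dz.
- have dz0 : is_derive (0 : R) 1 (fun s => z (p + s *: e)) z1.
    by rewrite -Z10; apply: dz; rewrite normr0.
  have := @is_derive_barrier' _ k eps eta _ _ _ _ _ _ _ (is_derive_line0 dg1) dz0 dZ1.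
  by rewrite p0 Z10; apply.
- by move=> t tr; rewrite /h p0; apply: hmax; exact: hr.
Qed.

(** With z = sqdist X a, ln z is superharmonic where z > 0 and z is strictly
    subharmonic, so the Laplacian of the function below is positive. *)
Lemma no_interior_max (f : T -> R) (a b : T) (k eps eta : R) :
  harmonic A (interior M) f -> 0 < eps -> 0 < eta -> interior M b ->
  0 < sqdist X a b ->
  ~ (\forall q \near b, k * f q - eps * ln (sqdist X a q) + eta * sqdist X a q <=
     k * f b - eps * ln (sqdist X a b) + eta * sqdist X a b).
Proof.
move=> hf eps0 eta0 Mb zb hmax.
have [c Ac cb] : (\bigcup_(c in A) chart_dom c) b by rewrite cover.
pose p := coord c b; pose D := coord_image c (interior M).
have Dp : D p by exists b.
have DT : D `<=` coord_image c setT by move=> _ [q [cq _] <-]; exists q.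
have nz : \forall q \near b, 0 < sqdist X a q.
  have /cvgr_dist_lt/(_ _ zb) := @sqdist_continuous _ _ _ _ _ cover hX a b.
  by apply: filterS => q; rewrite ltr_distlC subrr => /andP[].
have nM : nbhs b (interior M).
  by apply: open_nbhs_nbhs; split=> //; exact: open_interior.
pose z (p' : R * R) := (entry c i1 p' - X a 0 i1) * (entry c i1 p' - X a 0 i1) +
  (entry c i2 p' - X a 0 i2) * (entry c i2 p' - X a 0 i2) -
  (entry c i3 p' - X a 0 i3) * (entry c i3 p' - X a 0 i3).
have zE q : chart_dom c q -> sqdist X a q = z (coord c q).
  by move=> cq; rewrite sqdistE /z !entry_coord// !expr2.
pose g := local_expr c f.
have gE q : chart_dom c q -> g (coord c q) = f q.
  by move=> cq; rewrite /g /local_expr -/(param c _) coordK.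
pose D' := [set p' | [/\ D p', 0 < z p' &
  k * g p' - eps * ln (z p') + eta * z p' <= k * g p - eps * ln (z p) + eta * z p]].
have pD' : nbhs p D'.
  pose W := [set q | [/\ interior M q, 0 < sqdist X a q &
    k * f q - eps * ln (sqdist X a q) + eta * sqdist X a q <=
    k * f b - eps * ln (sqdist X a b) + eta * sqdist X a b]].
  have nW : nbhs b W by apply: filterS3 nM nz hmax.
  apply: filterS (param_near cb nW) => p' [cp' ep' [Mp' zp' mp']].
  move: zp' mp'; rewrite !zE// ep' -(gE _ cb) -(gE _ cp') ep' => zp' mp'.
  by split=> //; exists (param c p').
have [[_ [[dg1 _] [dg2 _]]] lap] := hf c Ac.
have [[dg _] _] := hf c Ac.
have [l l0 [hP hQ hPQ]] := interior_conformal_at hX Ac Dp.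
have z0 : 0 < z p by rewrite -zE.
have B1 := @barrier_second_derivative D' (entry c) (entry1 c) g ('D_e1 g) p e1
  (X a 0) (entry11 c ^~ p) ('D_e1 ('D_e1 g) p) k eps eta pD'
  (fun j p' (H : D' p') => let: And3 Dp' _ _ := H in
     let: And5 h _ _ _ _ := entry_C1 hX j Ac (DT _ Dp') in h)
  (fun j => let: And5 h _ _ _ _ := entry1_C1 hX j Ac (DT _ Dp) in h)
  (fun p' (H : D' p') => let: And3 Dp' _ _ := H in
     derivableP (diff_derivable (dg p' Dp')))
  (derivableP (diff_derivable (dg1 p Dp)))
  (fun p' (H : D' p') => let: And3 _ h _ := H in h)
  (fun p' (H : D' p') => let: And3 _ _ h := H in h).
have B2 := @barrier_second_derivative D' (entry c) (entry2 c) g ('D_e2 g) p e2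
  (X a 0) (entry22 c ^~ p) ('D_e2 ('D_e2 g) p) k eps eta pD'
  (fun j p' (H : D' p') => let: And3 Dp' _ _ := H in
     let: And5 _ h _ _ _ := entry_C1 hX j Ac (DT _ Dp') in h)
  (fun j => let: And5 _ h _ _ _ := entry2_C1 hX j Ac (DT _ Dp) in h)
  (fun p' (H : D' p') => let: And3 Dp' _ _ := H in
     derivableP (diff_derivable (dg p' Dp')))
  (derivableP (diff_derivable (dg2 p Dp)))
  (fun p' (H : D' p') => let: And3 _ h _ := H in h)
  (fun p' (H : D' p') => let: And3 _ _ h := H in h).
have lapg := lap p Dp; rewrite /laplacian -/g in lapg.
have H1 := entry_harmonic i1 Ac Dp; have H2 := entry_harmonic i2 Ac Dp.
have H3 := entry_harmonic i3 Ac Dp.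
move: B1 B2; rewrite -/(z p).
move: lapg H1 H2 H3; rewrite /dot.
move: ('D_e1 ('D_e1 g) p) ('D_e2 ('D_e2 g) p) => g11 g22.
move: (entry11 c i1 p) (entry11 c i2 p) (entry11 c i3 p) (entry22 c i1 p)
  (entry22 c i2 p) (entry22 c i3 p) => A1 A2 A3 B1 B2 B3 lapg H1 H2 H3.
have bessel := lorentz_bessel (entry c i1 p - X a 0 i1) (entry c i2 p - X a 0 i2)
  (entry c i3 p - X a 0 i3) l0 hP hQ hPQ.
move: z0 bessel hP hQ hPQ; rewrite -[z p]/(_ * _ + _ * _ - _ * _).
move: (entry1 c i1 p) (entry1 c i2 p) (entry1 c i3 p) (entry2 c i1 p) (entry2 c i2 p)
  (entry2 c i3 p) => P1 P2 P3 Q1 Q2 Q3.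
move: (entry c i1 p - X a 0 i1) (entry c i2 p - X a 0 i2) (entry c i3 p - X a 0 i3)
  => V1 V2 V3.
rewrite -!expr2; set w := V1 ^+ 2 + _ - _.
set vP := V1 * P1 + _ - _; set vQ := V1 * Q1 + _ - _.
move=> w0 bessel hP hQ hPQ; rewrite hP hQ.
set a1 := V1 * A1 + _ - _; set a2 := V1 * B1 + _ - _ => C1 C2.
have a12 : a2 = - a1.
  have E1 : B1 = - A1 by lra.
  have E2 : B2 = - A2 by lra.
  have E3 : B3 = - A3 by lra.
  by rewrite /a2 /a1 E1 E2 E3; ring.
have bes : l <= w^-1 * (vP ^+ 2 + vQ ^+ 2).
  by rewrite mulrC ler_pdivlMr// mulrC.
have w2 : w ^- 2 = w^-1 * w^-1 by rewrite -exprVn expr2.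
move: C1 C2; rewrite w2 a12; move: bes.
have : 0 < w^-1 by rewrite invr_gt0.
move: (w^-1) => i i0 bes C1 C2.
have p1 : 0 <= eps * (i * (i * (vP ^+ 2 + vQ ^+ 2) - l)).
  apply: mulr_ge0; first exact: ltW.
  by apply: mulr_ge0; [exact: ltW|rewrite subr_ge0].
have p2 : 0 < eta * l by rewrite mulr_gt0.
have p3 : k * g11 + k * g22 = 0 by rewrite -mulrDr lapg mulr0.
move: C1 C2 p1; clearbody vP vQ a1 a2 w; clear -p2 p3 => C1 C2 p1.
have C := lerD C1 C2.
suff : 4 * (eta * l) + 4 * (eps * (i * (i * (vP ^+ 2 + vQ ^+ 2) - l))) <= 0.
  by lra.
apply: le_trans (_ : _ <= 0 + 0) _; last by rewrite addr0.
apply: le_trans _ C; rewrite le_eqVlt; apply/orP; left; apply/eqP.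
rewrite -[LHS]add0r -p3; ring.
Qed.
End MaximumPrinciple.

(** * Relative parabolicity *)

Section Parabolicity.
Context {R : realType} {T : topologicalType}.
Variables (A : set (chart R T)) (M : set T) (L : set (set T)) (X : T -> 'rV[R]_3).
Hypotheses (cover : \bigcup_(c in A) chart_dom c = setT) (hT : hausdorff_space T)
  (hM : bordered_surface A M L) (hX : conformal_maximal_immersion A M X)
  (hproper : proper_on M X)
  (hcone : forall gamma, L gamma -> conelike_singularity A M X gamma).

(** A bounded harmonic function f with zero boundary values satisfies k f <= 0 for
    every real k; k = 1 and k = -1 give f = 0. *)
Lemma bounded_harmonic_le0 (f : T -> R) (k : R) (gamma : set T) (a q : T) :
  L gamma -> gamma a ->
  {within M, continuous f} -> harmonic A (interior M) f ->
  (exists B : R, forall q, M q -> `|f q| <= B) ->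
  (forall q, frontier M q -> f q = 0) -> M q -> k * f q <= 0.
Proof.
move=> Lg ga fc hf [B hB] f0 Mq; rewrite leNgt; apply/negP.
set m := k * f q => m0.
have Ma : M a by exact/(frontier_sub hM)/(loop_sub_frontier hM Lg).
pose Z := sqdist X a.
have Zc : continuous Z := @sqdist_continuous _ _ _ _ _ cover hX a.
have Zpos b : M b -> f b != 0 -> 0 < Z b.
  move=> Mb /eqP fb; apply: (sqdist_gt0 cover hT hM hX hproper hcone) => // ab.
  apply: fb; apply: f0; case: ab => [<-|[g L' [_ gb]]].
    exact: (loop_sub_frontier hM Lg).
  exact: (loop_sub_frontier hM L').
have fneq b : 0 < k * f b -> f b != 0.
  by apply: contraTneq => ->; rewrite mulr0 ltxx.
have Zq : 0 < Z q by apply: Zpos => //; exact: fneq.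
have m20 : 0 < m / 2 by rewrite divr_gt0.
(* Where k f is at least m / 2, the function Z has a positive minimum t. *)
have [t [t0 tq ht]] : exists t, [/\ 0 < t, t <= Z q &
    forall b, M b -> Z b < t -> k * f b < m / 2].
  have cS : closed ((fun b => k * f b) @^-1` [set s | m / 2 <= s] : set (subspace M)).
    apply: preimage_closed; last exact: closed_ge.
    move=> b _; have kc : {for b, continuous (fun _ : subspace M => k)} by exact: cst_continuous.
    exact: (continuousM kc (fc b)).
  move/closed_subspaceP: cS => [W cW WE].
  have WP b : M b -> W b <-> m / 2 <= k * f b.
    move=> Mb; split=> h.
      by have : (W `&` M) b by []; rewrite WE => -[].
    suff : (W `&` M) b by case.
    by rewrite WE; split.
  have cK : compact ((M `&` [set b | Z b <= Z q]) `&` W).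
    by apply: compact_closedI => //; exact: (sqdist_proper cover hT hM hX hproper hcone).
  have K0 : ((M `&` [set b | Z b <= Z q]) `&` W) !=set0.
    exists q; split; first by split=> //=.
    by apply/(WP _ Mq); rewrite -/m; lra.
  have [c /set_mem[[Mc Zcq] Wc] hc] := compact_EVT_min K0 cK (continuous_subspaceT Zc).
  exists (Z c); split=> //.
    by apply: Zpos => //; apply: fneq; move/(WP _ Mc): Wc; exact: lt_le_trans.
  move=> b Mb Zbc; rewrite ltNge; apply/negP => /(WP _ Mb) Wb.
  have : Z c <= Z b.
    by apply: hc; apply/mem_set; split=> //; split=> //=; rewrite (le_trans _ Zcq)// ltW.
  by rewrite leNgt Zbc.
pose t1 := t / 2.
have t10 : 0 < t1 by rewrite divr_gt0.
have t1t : t1 < t by rewrite /t1; lra.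
pose B0 := `|k| * `|B| + 1.
have B0p : 0 < B0 by rewrite ltr_wpDl// mulr_ge0.
have kfB b : M b -> k * f b <= B0.
  move=> Mb; rewrite (le_trans (ler_norm _))// normrM.
  have : `|k| * `|f b| <= `|k| * `|B|.
    by rewrite ler_wpM2l// (le_trans (hB b Mb))// ler_norm.
  by rewrite /B0; lra.
have lnq : ln t1 <= ln (Z q).
  by rewrite ler_ln ?posrE//; exact: le_trans (ltW t1t) tq.
(* The barrier - eps ln Z + eta Z costs at most m / 8 at q; it exceeds the bound B0
   of k f at the level Tm of Z, and eta Z is at most m / 8 up to that level. *)
pose eps := m / 8 / (ln (Z q) - ln t1 + 1).
have den : 0 < ln (Z q) - ln t1 + 1 by lra.
have eps0 : 0 < eps by rewrite divr_gt0// divr_gt0.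
have epsq : eps * (ln (Z q) - ln t1) <= m / 8.
  have : eps * (ln (Z q) - ln t1 + 1) = m / 8 by rewrite mulfVK// gt_eqF.
  by rewrite mulrDr mulr1; lra.
pose Tm := Z q + t1 * expR (B0 / eps).
have Tq : Z q < Tm by rewrite ltrDl mulr_gt0// expR_gt0.
have Tm0 : 0 < Tm by exact: lt_trans Tq.
have lnT : ln t1 + B0 / eps <= ln Tm.
  rewrite -{1}(expRK (B0 / eps)) -lnM ?posrE ?expR_gt0//.
  by rewrite ler_ln ?posrE// ?mulr_gt0 ?expR_gt0// lerDr ltW.
pose eta := m / 8 / Tm.
have eta0 : 0 < eta by rewrite divr_gt0// divr_gt0.
have etaT b : Z b <= Tm -> eta * Z b <= m / 8.
  move=> ZT; have : eta * Tm = m / 8 by rewrite mulfVK// gt_eqF.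
  by move=> <-; rewrite ler_pM2l.
pose Phi b := k * f b - eps * ln (Z b) + eta * Z b.
pose K := (M `&` [set b | Z b <= Tm]) `&` [set b | t1 <= Z b].
have cK : compact K.
  apply: compact_closedI; first exact: (sqdist_proper cover hT hM hX hproper hcone).
  have -> : [set b | t1 <= Z b] = Z @^-1` [set s | t1 <= s] by [].
  by apply: preimage_closed; [move=> b _; exact: Zc|exact: closed_ge].
have Kq : K q.
  by split; [split=> //=; exact: ltW|rewrite /= (le_trans _ tq)// ltW].
have PhiC : {within K, continuous Phi}.
  have KM : K `<=` M by move=> b [[]].
  have fK : {within K, continuous f} by exact: continuous_subspaceW KM fc.
  have ZK : {within K, continuous Z} by exact: continuous_subspaceT.
  have lK : {within K, continuous (fun b => ln (Z b))}.
    apply: continuous_in_subspaceT => b /set_mem[_ /= tb].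
    have Zb : 0 < Z b by exact: lt_le_trans tb.
    exact: (continuous_comp (Zc b) (continuous_ln Zb)).
  move=> b; have cc (s : R) : {for b, continuous (fun _ : subspace K => s)} by exact: cst_continuous.
  exact: (continuousD (continuousB (continuousM (cc k) (fK b)) (continuousM (cc eps) (lK b)))
    (continuousM (cc eta) (ZK b))).
have K0 : K !=set0 by exists q.
have [c /set_mem Kc hc] := compact_EVT_max K0 cK PhiC.
(* The maximum of Phi is too large to be attained where Z < t, where Z = Tm, or on
   the frontier of M. *)
have Phiq : m * (7 / 8) - eps * ln t1 <= Phi c.
  apply: le_trans (hc q (mem_set Kq)); rewrite /Phi -/m.
  have : 0 <= eta * Z q by rewrite mulr_ge0 ?ltW.
  by move: epsq; rewrite mulrBr; lra.
have [[Mc /= ZcT] /= Zct] := Kc.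
have Zc0 : 0 < Z c by exact: lt_le_trans Zct.
have lnc : eps * ln t1 <= eps * ln (Z c).
  by rewrite ler_pM2l// ler_ln ?posrE.
have etac := etaT c ZcT.
have Zct' : t <= Z c.
  rewrite leNgt; apply/negP => Zct2; have := ht c Mc Zct2.
  by move: Phiq; rewrite /Phi; lra.
have ZcT' : Z c < Tm.
  rewrite lt_neqAle ZcT andbT; apply/eqP => ZT.
  have : eps * (ln t1 + B0 / eps) <= eps * ln Tm by rewrite ler_pM2l.
  rewrite mulrDr mulrCA divff ?gt_eqF// mulr1 -ZT.
  by move: Phiq (kfB c Mc); rewrite /Phi; lra.
have Mi : interior M c.
  apply: contrapT => nMi; have : frontier M c by split=> //; exact: subset_closure.
  move=> /f0 fc0; move: Phiq; rewrite /Phi fc0 mulr0; lra.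
apply: (no_interior_max cover hX hf eps0 eta0 Mi Zc0 (k := k)).
have n1 : nbhs c (interior M).
  by apply: open_nbhs_nbhs; split=> //; exact: open_interior.
have n2 : \forall b \near c, t1 < Z b.
  have tc : 0 < Z c - t1 by rewrite subr_gt0 (lt_le_trans t1t).
  have /cvgr_dist_lt/(_ _ tc) := Zc c.
  by apply: filterS => b; rewrite ltr_distlC => /andP[lo _]; lra.
have n3 : \forall b \near c, Z b < Tm.
  have tc : 0 < Tm - Z c by rewrite subr_gt0.
  have /cvgr_dist_lt/(_ _ tc) := Zc c.
  by apply: filterS => b; rewrite ltr_distlC => /andP[_ hi]; lra.
apply: filterS3 n1 n2 n3 => b Mb b1 b2; apply: hc; apply/mem_set.
by split; [split; [exact: interior_subset|exact: ltW]|exact: ltW].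
Qed.
End Parabolicity.

Theorem corollary3p3 (R : realType) (M' : topologicalType)
    (A : set (chart R M')) (M : set M') (L : set (set M'))
    (X : M' -> 'rV[R]_3)
    (hM' : open_riemann_surface A)
    (hM : bordered_surface A M L)
    (hbd : frontier M !=set0)
    (hX : conformal_maximal_immersion A M X)
    (hproper : proper_on M X)
    (hcount : countable L)
    (hcone : forall gamma, L gamma -> conelike_singularity A M X gamma) :
  relative_parabolic A M.
Proof.
move=> f fc hf hB f0 q Mq.
have [a] := hbd; rewrite (bs_frontier hM) => -[gamma Lg ga].
have hT := rs_hausdorff hM'.1; have cover := rs_cover hM'.1.
have le0 k := bounded_harmonic_le0 cover hT hM hX hproper hcone k Lg ga fc hf hB f0 Mq.
by apply/le_anti; move: (le0 1) (le0 (-1)); rewrite mul1r mulN1r oppr_le0 => -> ->.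
Qed.
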